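(* Let $m\ge2$ and let $(p:\mathcal P\to N,\omega)$ be a lightlike Cartan geometry on an $(m+1)$-dimensional manifold $N$. Then $N$ is endowed with the following structures: (1) A lightlike metric $h^\omega$ and a vector field $Z^\omega$ spanning its radical distribution. (2) A map $\nabla^\omega$ that assigns to each $\tau\in S(N,h^\omega,Z^\omega)$ a metric linear connection $\nabla^\tau$ on the vector bundle $(\mathrm{An}(\tau)\to N,h^\omega)$, such that for any $\tau,\bar\tau\in S(N,h^\omega,Z^\omega)$, any section $X\in\Gamma(\mathrm{An}(\tau))$ and any $W\in\mathfrak X(N)$, $$\nabla^{\bar\tau}_W(P^{\bar\tau}(X))=P^{\bar\tau}\big(\nabla^\tau_WX-\bar\tau(X)W\big)-h^\omega(X,W)L_{\tau,\bar\tau}.$$ (3) A map $D^\omega$ that assigns to each $\tau\in S(N,h^\omega,Z^\omega)$ a vector bundle morphism $D^\tau:TN\to\mathrm{An}(\tau)$, such that for any $\tau,\bar\tau\in S(N,h^\omega,Z^\omega)$ and any $W\in\mathfrak X(N)$, $$D^{\bar\tau}(W)=P^{\bar\tau}\Big(D^\tau(W)+\tfrac12h^\omega(L_{\tau,\bar\tau},L_{\tau,\bar\tau})W\Big)-\tau(W)L_{\tau,\bar\tau}-\nabla^{\bar\tau}_WL_{\tau,\bar\tau}.$$ Here $h^\omega,Z^\omega,\nabla^\omega,D^\omega$ are the objects canonically constructed from $\omega$ as in the context.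
   Context: Conventions. Manifolds are smooth, Hausdorff, connected, second countable. $\mathbb L^{m+2}$ is $\mathbb R^{m+2}$ with its Lorentzian inner product $\langle\,,\rangle$ of signature $(m+1,1)$ and a fixed basis $(\ell,e_1,\dots,e_m,n)$ with $\ell$ in the future lightlike cone, $\langle \ell,n\rangle=1$, $\langle e_i,e_j\rangle=\delta_{ij}$ and all other products of basis vectors zero. $G=O^+(m+1,1)$ is the group of linear isometries of $\mathbb L^{m+2}$ preserving the future lightlike cone, $H\subset G$ is the isotropy subgroup of $\ell$, with Lie algebras $\mathfrak h\subset\mathfrak g$. In the fixed basis $\mathfrak g$ consists of the matrices $\begin{pmatrix} a&\zeta&0\\ X&A&-\zeta^t\\0&-X^t&-a\end{pmatrix}$ with $a\in\mathbb R$, $X\in\mathbb R^m$, $\zeta\in(\mathbb R^m)^*$, $A\in\mathfrak o(m)$, and $\mathfrak h$ is given by $a=0,X=0$; so $\mathfrak g/\mathfrak h\cong\mathbb R\times\mathbb R^m$ via $(a,X)$. Lightlike Cartan geometry. A lightlike Cartan geometry on $N$ is a principal bundle $p:\mathcal P\to N$ with structure group $H$ and $\omega\in\Omega^1(\mathcal P,\mathfrak g)$ such that each $\omega(u):T_u\mathcal P\to\mathfrak g$ is a linear isomorphism, $(r^h)^*\omega=\mathrm{Ad}(h^{-1})\circ\omega$ for $h\in H$, and $\omega(\zeta_X)=X$ for the fundamental vector field $\zeta_X$ of each $X\in\mathfrak h$. For $u\in\mathcal P$, $x=p(u)$, let $\phi_u:T_xN\to\mathfrak g/\mathfrak h$ be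 the isomorphism with $\phi_u(T_up\cdot\zeta)=\omega(u)(\zeta)+\mathfrak h$. With $q((a,X),(b,Y))=X^tY$ on $\mathbb R\times\mathbb R^m$, put $h^\omega(v,w)=q(\phi_u v,\phi_u w)$ and $Z^\omega_x=\phi_u^{-1}(1,0)$ (independent of $u$). A lightlike metric is a symmetric positive semidefinite $(0,2)$-tensor $h$ whose radical $\{v:h(v,\cdot)=0\}$ is one-dimensional at each point. $S(N,h^\omega,Z^\omega)=\{\tau\in\Omega^1(N,\mathbb R):\tau(Z^\omega)=1\}$, $\mathrm{An}(\tau)=\ker\tau\subset TN$ with positive definite metric $h^\omega$, $P^\tau(v)=v-\tau(v)Z^\omega$. For $\tau,\bar\tau\in S(N,h^\omega,Z^\omega)$, $L_{\tau,\bar\tau}=\sum_{i=1}^m\tau(E_i)E_i$ for any local $h^\omega$-orthonormal frame $(E_i)$ of $\mathrm{An}(\bar\tau)$. Tractor bundle. $\mathcal T=\mathcal P\times_H\mathbb L^{m+2}$ with metric $\mathbf h([u,v_1],[u,v_2])=\langle v_1,v_2\rangle$ and the $\mathbf h$-metric connection $\nabla^{\mathcal T}$ induced by the unique principal connection on $\mathcal P\times_HG$ restricting to $\omega$ on $\mathcal P$; locally $\nabla^{\mathcal T}_W[s,f]=[s,W(f)+\omega(Ts\cdot W)f]$ for a local section $s$ of $\mathcal P$ and an $\mathbb L^{m+2}$-valued function $f$. Put $\xi_x=[u,\ell]$ ($p(u)=x$) and $\Phi(W)=\nabla^{\mathcal T}_W\xi$, a bundle monomorphism $TN\to\mathcal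 T$ with image $\xi^\perp$, isometric from $h^\omega$ to $\mathbf h$, with $\Phi(Z^\omega)=\xi$. For $\tau\in S(N,h^\omega,Z^\omega)$ let $\eta^\tau$ be the unique lightlike section of $\mathcal T$ with $\mathbf h(\xi,\eta^\tau)=1$, $\mathbf h(\Phi(\mathrm{An}(\tau)),\eta^\tau)=0$; every section is uniquely $\alpha\xi+\Phi(X)+\beta\eta^\tau$ with $X\in\Gamma(\mathrm{An}(\tau))$. For $X\in\Gamma(\mathrm{An}(\tau))$, $\nabla^\tau_WX$ and $D^\tau(W)$ are defined as the $\mathrm{An}(\tau)$-components of $\nabla^{\mathcal T}_W\Phi(X)$ and $\nabla^{\mathcal T}_W\eta^\tau$ respectively; $\nabla^\omega:\tau\mapsto\nabla^\tau$ and $D^\omega:\tau\mapsto D^\tau$. *)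

(* Defs.v *)
From HB Require Import structures.
From mathcomp Require Export all_boot all_order all_algebra.
From mathcomp Require Export all_classical all_reals all_analysis.
Set Implicit Arguments.
Unset Strict Implicit.
Unset Printing Implicit Defensive.
Export Order.TTheory GRing.Theory Num.Theory.
Export numFieldNormedType.Exports.
Local Open Scope classical_set_scope.
Local Open Scope ring_scope.

Section SmoothMaps.
Context {R : realType} {V W : normedModType R}.

(* For finite-dimensional V and W (the only case used) and open O this is the
   usual class C^k: on O, f is differentiable and every directional derivative
   'D_v f is again C^(k-1). *)
Fixpoint Ck_on (k : nat) (O : set V) (f : V -> W) : Prop :=
  match k with
  | 0%N => forall x, O x -> {for x, continuous f}
  | k'.+1 => (forall x, O x -> differentiable f x) /\
             (forall v : V, Ck_on k' O ('D_v f))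
  end.

(* C^oo on some neighbourhood of x *)
Definition smooth_at (f : V -> W) (x : V) : Prop :=
  exists O : set V, [/\ open O, O x & forall k, Ck_on k O f].

End SmoothMaps.

(* A smooth manifold of dimension n, presented by a smooth atlas
   (chart x)_(x : M) such that x lies in the domain of chart x: the chart at x
   is cmap x, defined on cdom x, with inverse cinv x on the image.  Every atlas
   contains such a subatlas, and it determines the smooth structure.
   Connectedness is not part of the record, see [connected_manifold]. *)
Record manifold (R : realType) (n : nat) := Manifold {
  points :> topologicalType;
  cdom : points -> set points;
  cmap : points -> points -> 'rV[R]_n;
  cinv : points -> 'rV[R]_n -> points;
  manifold_hausdorff : hausdorff_space points;
  manifold_second_countable : @second_countable points;
  cdom_open : forall x, open (cdom x);
  cdom_self : forall x, cdom x x;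
  cmap_open : forall x, open (cmap x @` cdom x);
  cmapK : forall x y, cdom x y -> cinv x (cmap x y) = y;
  cmap_continuous : forall x y, cdom x y -> {for y, continuous (cmap x)};
  cinv_continuous : forall x y, cdom x y ->
    {for cmap x y, continuous (cinv x)};
  transition_smooth : forall x x' y, cdom x y -> cdom x' y ->
    smooth_at (cmap x' \o cinv x) (cmap x y)
}.

Definition connected_manifold (R : realType) (n : nat) (M : manifold R n) :=
  connected [set: M].

(* The tangent space T_x M is identified with R^n by means of the chart at x:
   v : 'rV_n stands for the tangent vector at x whose components in the chart
   cmap x are v.  The next two maps pass between this representation and
   components with respect to a chart centred at another point. *)
Section TangentSpaces.
Context {R : realType} {n : nat} {M : manifold R n}.
Implicit Types x y : M.

(* components, in the chart at x, of v in T_y M *)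
Definition components x y (v : 'rV[R]_n) : 'rV[R]_n :=
  'd (cmap x \o cinv y) (cmap y y) v.

(* the element of T_y M whose components in the chart at x are v; for fixed v
   and varying y it is a coordinate vector field on cdom x *)
Definition coord_field x (v : 'rV[R]_n) y : 'rV[R]_n :=
  'd (cmap y \o cinv x) (cmap x y) v.

Definition vfield := M -> 'rV[R]_n.

Definition smooth_vfield (X : vfield) : Prop :=
  forall x, smooth_at (fun z => components x (cinv x z) (X (cinv x z)))
                      (cmap x x).

Definition smooth_fun_at {E : normedModType R} (f : M -> E) x : Prop :=
  smooth_at (f \o cinv x) (cmap x x).

Definition smooth_fun {E : normedModType R} (f : M -> E) : Prop :=
  forall x, smooth_fun_at f x.

(* derivative of f at x along the tangent vector w *)
Definition dfun {E : normedModType R} (f : M -> E) x (w : 'rV[R]_n) : E :=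
  'd (f \o cinv x) (cmap x x) w.

(* E-valued 1-forms, given as families of linear maps on the tangent spaces *)
Definition smooth_form {E : normedModType R} (w : M -> 'rV[R]_n -> E) : Prop :=
  (forall x, linear (w x)) /\
  (forall x v, smooth_fun_at (fun y => w y (coord_field x v y)) x).

(* symmetric (0,2)-tensor fields *)
Definition smooth_symmetric_tensor (h : M -> 'rV[R]_n -> 'rV[R]_n -> R) :=
  [/\ forall x v, scalar (h x v),
      forall x v w, h x v w = h x w v &
      forall x v w, smooth_fun_at
        (fun y => h y (coord_field x v y) (coord_field x w y) : R^o) x].

(* velocity at t = 0 of a curve in M starting at x *)
Definition velocity x (c : R -> M) : 'rV[R]_n := 'D_1 (cmap x \o c) (0 : R^o).

End TangentSpaces.
Arguments vfield {R n} M.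

Section MapsOfManifolds.
Context {R : realType} {n k : nat} {M : manifold R n} {M' : manifold R k}.

Definition smooth_map_at (f : M -> M') (x : M) : Prop :=
  {for x, continuous f} /\
  smooth_at (cmap (f x) \o f \o cinv x) (cmap x x).

Definition tangent_map (f : M -> M') (x : M) (v : 'rV[R]_n) : 'rV[R]_k :=
  'd (cmap (f x) \o f \o cinv x) (cmap x x) v.

End MapsOfManifolds.

Section LorentzModel.
Context {R : realType} {m : nat}.

(* L^(m+2) in the basis (l, e_1, ..., e_m, n) *)
Definition lvec : 'cV[R]_(1 + m + 1) := col_mx (col_mx 1%:M 0) 0.
Definition nvec : 'cV[R]_(1 + m + 1) := col_mx 0 1%:M.

Definition gram : 'M[R]_(1 + m + 1) :=
  block_mx (block_mx 0 0 0 1%:M) (col_mx 1%:M 0) (row_mx 1%:M 0) 0.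

Definition lorentz (v w : 'cV[R]_(1 + m + 1)) : R := (v^T *m gram *m w) 0 0.

(* The vector l - n is timelike and lorentz l (l - n) = -1, so this is the half
   of the cone of nonzero lightlike vectors that contains l. *)
Definition future_cone (v : 'cV[R]_(1 + m + 1)) : Prop :=
  [/\ v != 0, lorentz v v = 0 & lorentz v (lvec - nvec) < 0].

Definition Ggrp : set 'M[R]_(1 + m + 1) :=
  [set g | (forall v w, lorentz (g *m v) (g *m w) = lorentz v w) /\
           (forall v, future_cone v -> future_cone (g *m v))].

Definition Hgrp : set 'M[R]_(1 + m + 1) :=
  [set g | Ggrp g /\ g *m lvec = lvec].

Definition gmx (a : R) (X : 'cV[R]_m) (zeta : 'rV[R]_m) (A : 'M[R]_m) :
    'M[R]_(1 + m + 1) :=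
  block_mx (block_mx a%:M zeta X A) (col_mx 0 (- zeta^T))
           (row_mx 0 (- X^T)) (- a)%:M.

Definition galg : set 'M[R]_(1 + m + 1) :=
  [set B | exists a X zeta A, A^T = - A /\ B = gmx a X zeta A].

Definition halg : set 'M[R]_(1 + m + 1) :=
  [set B | exists zeta A, A^T = - A /\ B = gmx 0 0 zeta A].

(* the projection of galg onto galg / halg = R x R^m *)
Definition gmodh (B : 'M[R]_(1 + m + 1)) : R * 'cV[R]_m :=
  (ulsubmx (ulsubmx B) 0 0, dlsubmx (ulsubmx B)).

Definition qform (y z : R * 'cV[R]_m) : R := (y.2^T *m z.2) 0 0.

End LorentzModel.

Section PrincipalBundles.
Context {R : realType} {m d : nat} {N : manifold R m.+1} {P : manifold R d}.
Variables (p : P -> N) (act : P -> 'M[R]_(1 + m + 1) -> P).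

(* Smoothness at (u, g) of the action P x H -> P.  H is a closed embedded
   submanifold of the matrices, so smoothness means that, in charts of P, the
   action locally extends to a smooth map of (point, matrix). *)
Definition smooth_action_at (u : P) (g : 'M[R]_(1 + m + 1)) : Prop :=
  exists F : 'rV[R]_d * 'M[R]_(1 + m + 1) -> 'rV[R]_d,
    smooth_at F (cmap u u, g) /\
    \forall zk \near (cmap u u, g), Hgrp zk.2 ->
      cdom (act u g) (act (cinv u zk.1) zk.2) /\
      cmap (act u g) (act (cinv u zk.1) zk.2) = F zk.

(* In a local trivialization over U, s is the local section and g the
   H-component: (y, k) |-> act (s y) k and u |-> (p u, g u) are mutually inverse
   equivariant diffeomorphisms between U x H and the preimage of U. *)
Record principal_bundle : Prop := PrincipalBundle {
  proj_smooth : forall u, smooth_map_at p u;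
  act_smooth : forall u k, Hgrp k -> smooth_action_at u k;
  act1 : forall u, act u 1%:M = u;
  actM : forall u k k', Hgrp k -> Hgrp k' -> act u (k *m k') = act (act u k) k';
  proj_act : forall u k, Hgrp k -> p (act u k) = p u;
  locally_trivial : forall x : N,
    exists (U : set N) (s : N -> P) (g : P -> 'M[R]_(1 + m + 1)),
      [/\ open U /\ U x,
          forall y, U y -> smooth_map_at s y /\ p (s y) = y,
          forall u, U (p u) ->
            [/\ smooth_fun_at g u, Hgrp (g u) & act (s (p u)) (g u) = u] &
          forall y k, U y -> Hgrp k -> g (act (s y) k) = k]
}.

(* The fundamental vector field of B in halg at u: the image of B under the
   differential at 1 of the orbit map k |-> act u k.  Tangent vectors of H at 1
   are velocities of curves in H. *)
Definition fundamental (B : 'M[R]_(1 + m + 1)) (u : P) : 'rV[R]_d :=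
  get [set z | forall c : R^o -> 'M[R]_(1 + m + 1),
    (forall t, smooth_at c t) -> (forall t, Hgrp (c t)) ->
    c 0 = 1%:M -> 'D_1 c 0 = B ->
    z = velocity u (fun t => act u (c t))].

End PrincipalBundles.

Record lightlike_cartan (R : realType) (m d : nat)
    (N : manifold R m.+1) (P : manifold R d) := LightlikeCartan {
  proj : P -> N;
  act : P -> 'M[R]_(1 + m + 1) -> P;
  omega : P -> 'rV[R]_d -> 'M[R]_(1 + m + 1);
  cartan_principal : principal_bundle proj act;
  omega_smooth : smooth_form omega;
  omega_galg : forall u z, galg (omega u z);
  omega_inj : forall u, injective (omega u);
  omega_surj : forall u B, galg B -> exists z, omega u z = B;
  omega_equivariant : forall u k z, Hgrp k ->
    omega (act u k) (tangent_map (fun u' => act u' k) u z)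
    = invmx k *m omega u z *m k;
  omega_fundamental : forall u B, halg B -> omega u (fundamental act B u) = B
}.

(* The objects below are given by definite descriptions: [get A] is the unique
   element of A when A is a singleton. *)
Section CartanConstructions.
Context {R : realType} {m d : nat} {N : manifold R m.+1} {P : manifold R d}.
Variable C : lightlike_cartan N P.
Notation TN := 'rV[R]_m.+1.
Notation L := 'cV[R]_(1 + m + 1).
Notation p := (proj C).

Definition phi (u : P) (v : TN) : R * 'cV[R]_m :=
  get [set y | forall z, tangent_map p u z = v -> y = gmodh (omega C u z)].

Definition hmetric (x : N) (v w : TN) : R :=
  get [set r | forall u, p u = x -> r = qform (phi u v) (phi u w)].

Definition Zfield : vfield N := fun x =>
  get [set v | forall u, p u = x -> phi u v = (1, 0)].

(* S(N, h, Z) *)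
Definition Sforms : set (N -> TN -> R^o) :=
  [set tau : N -> TN -> R^o | smooth_form tau /\ forall x, tau x (Zfield x) = 1].

(* sections of An(tau) *)
Definition An_section (tau : N -> TN -> R^o) (X : vfield N) : Prop :=
  smooth_vfield X /\ forall x, tau x (X x) = 0.

Definition Pproj (tau : N -> TN -> R^o) (x : N) (v : TN) : TN :=
  v - tau x v *: Zfield x.

(* L_(tau, taub) *)
Definition Lfield (tau taub : N -> TN -> R^o) : vfield N := fun x =>
  get [set y | forall E : 'I_m -> TN,
    (forall i, taub x (E i) = 0) ->
    (forall i j, hmetric x (E i) (E j) = (i == j)%:R) ->
    y = \sum_i tau x (E i) *: E i].

(* Elements of the tractor bundle are the H-orbits [u, v] in P x L. *)
Definition tractor (u : P) (v : L) : set (P * L) :=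
  [set y | exists2 k, Hgrp k & y = (act C u k, invmx k *m v)].

Definition tractor_fibre (x : N) : set (set (P * L)) :=
  [set t | exists u v, p u = x /\ t = tractor u v].

Definition tadd (t t' : set (P * L)) : set (P * L) :=
  get [set t'' | forall u v v', t = tractor u v -> t' = tractor u v' ->
    t'' = tractor u (v + v')].

Definition tscale (a : R) (t : set (P * L)) : set (P * L) :=
  get [set t' | forall u v, t = tractor u v -> t' = tractor u (a *: v)].

Definition tmetric (t t' : set (P * L)) : R :=
  get [set r | forall u v v', t = tractor u v -> t' = tractor u v' ->
    r = lorentz v v'].

(* The tractor connection, for sections sigma with a local representation
   sigma = [s, f], s a smooth local section of P and f a smooth function. *)
Definition nablaT (sigma : N -> set (P * L)) (x : N) (w : TN) : set (P * L) :=
  get [set t | forall (s : N -> P) (f : N -> L),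
    smooth_map_at s x -> smooth_fun_at f x ->
    (\forall y \near x, p (s y) = y /\ sigma y = tractor (s y) (f y)) ->
    t = tractor (s x) (dfun f x w + omega C (s x) (tangent_map s x w) *m f x)].

Definition xi (x : N) : set (P * L) :=
  get [set t | forall u, p u = x -> t = tractor u lvec].

Definition Phi (x : N) (w : TN) : set (P * L) := nablaT xi x w.

(* The unique lightlike element of the fibre at x normalized by xi and
   orthogonal to Phi(An(tau)); it is nonzero since tmetric (xi x) t = 1. *)
Definition eta (tau : N -> TN -> R^o) (x : N) : set (P * L) :=
  get [set t | [/\ tractor_fibre x t, tmetric t t = 0, tmetric (xi x) t = 1 &
    forall v, tau x v = 0 -> tmetric (Phi x v) t = 0]].

(* the An(tau)-component X of t = alpha xi + Phi(X) + beta eta *)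
Definition An_component (tau : N -> TN -> R^o) (x : N) (t : set (P * L)) : TN :=
  get [set X | tau x X = 0 /\ exists alpha beta : R,
    t = tadd (tadd (tscale alpha (xi x)) (Phi x X)) (tscale beta (eta tau x))].

(* nabla^omega : tau |-> nabla^tau *)
Definition nablaC (tau : N -> TN -> R^o) (W X : vfield N) : vfield N := fun x =>
  An_component tau x (nablaT (fun y => Phi y (X y)) x (W x)).

(* D^omega : tau |-> D^tau *)
Definition DC (tau : N -> TN -> R^o) (x : N) (w : TN) : TN :=
  An_component tau x (nablaT (eta tau) x w).

(* metric linear connections on (An(tau), hmetric) *)
Definition metric_connection (tau : N -> TN -> R^o)
    (nabla : vfield N -> vfield N -> vfield N) : Prop :=
  [/\ (forall W X, smooth_vfield W -> An_section tau X ->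
         An_section tau (nabla W X)),
      (forall (f : N -> R^o) W W' X, smooth_fun f ->
         smooth_vfield W -> smooth_vfield W' -> An_section tau X -> forall x,
         nabla (fun y => f y *: W y + W' y) X x
         = f x *: nabla W X x + nabla W' X x),
      (forall W X X', smooth_vfield W ->
         An_section tau X -> An_section tau X' -> forall x,
         nabla W (fun y => X y + X' y) x = nabla W X x + nabla W X' x),
      (forall (f : N -> R^o) W X, smooth_fun f ->
         smooth_vfield W -> An_section tau X -> forall x,
         nabla W (fun y => f y *: X y) x
         = dfun f x (W x) *: X x + f x *: nabla W X x) &
      (forall W X Y, smooth_vfield W ->
         An_section tau X -> An_section tau Y -> forall x,
         dfun (fun y => hmetric y (X y) (Y y) : R^o) x (W x)
         = hmetric x (nabla W X x) (Y x) + hmetric x (X x) (nabla W Y x))].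

(* vector bundle morphisms TN -> An(tau) over the identity *)
Definition An_bundle_morphism (tau : N -> TN -> R^o) (D : N -> TN -> TN) :=
  [/\ forall x, linear (D x),
      forall x w, tau x (D x w) = 0 &
      forall W, smooth_vfield W -> smooth_vfield (fun x => D x (W x))].

End CartanConstructions.

Section LightlikeMetrics.
Context {R : realType} {n : nat} {N : manifold R n}.

Definition radical (h : N -> 'rV[R]_n -> 'rV[R]_n -> R) (x : N) :
    set 'rV[R]_n :=
  [set v | forall w, h x v w = 0].

Definition spans (v : 'rV[R]_n) (A : set 'rV[R]_n) : Prop :=
  v != 0 /\ A = [set w | exists c : R, w = c *: v].

Definition lightlike_metric (h : N -> 'rV[R]_n -> 'rV[R]_n -> R) : Prop :=
  [/\ smooth_symmetric_tensor h,
      forall x v, 0 <= h x v v &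
      forall x, exists v, spans v (radical h x)].

End LightlikeMetrics.

(* Main.v *)
Require Import Defs.
From HB Require Import structures.
From mathcomp Require Import ring lra.
Set Implicit Arguments.
Unset Strict Implicit.
Unset Printing Implicit Defensive.
Local Open Scope classical_set_scope.
Local Open Scope ring_scope.

(* In a local section [s] of the bundle everything becomes linear algebra in
   L^(m+2).  The map [psi u : w |-> omega(z) l], for any lift [z] of [w], is an
   isomorphism of T_x N onto the hyperplane orthogonal to l; it turns h^omega into
   the Lorentz product and Z^omega into l, and [psi (u k) = k^-1 psi u].  It is well
   defined because vertical vectors are velocities of orbits of curves in H, which
   [omega] sends into h.  A form [tau] with [tau Z = 1] is [<psi w, f>] for a unique
   lightlike [f] with [<l, f> = 1], and this [f] represents [eta^tau].  With
   [A = omega o Ts] and [pr_f t = t - <t,f> l - <t,l> f], the section [V = psi X]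
   of An(tau) has covariant derivative [pr_f (dV + A V)], and D^tau is
   [pr_f (df + A f)].  Moreover [L_(tau,taub)] is represented by
   [pr_fb f = f - fb - <f,fb> l], so both transformation rules follow by
   expanding the projections, using that [A] is skew and [A l = psi]. *)

(** * Calculus of C^k and smooth maps *)

(** The geometric objects are definite descriptions [get] over all lifts, frames or local
    representatives, so a formula in one section s is available only once independence of the choice
    is proved. For [nablaT] this means comparing s with s k, hence differentiating the action along
    a moving group element. The axioms on [omega] cover only right translations and fundamental
    fields; [omega_leibniz] combines the two. In the transformation rules write q = psi W and D = d
    + A. Since <V,l> = 0 and <f,l> = 1 are constant and D l = q, metricity gives <DV,l> = -h(X,W)
    and <Df,l> = -tau(W). A vector t is pr_f t + <t,f> l + <t,l> f and pr_fb kills l, so the last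
    summand produces -h(X,W) L and -tau(W) L. The factor 1/2 comes from L = f - fb - <f,fb> l, whose
    square is -2 <f,fb>: the term -<f,fb> q, left by differentiating the multiple of l, is 1/2
    h(L,L) q. *)

Section CkCalculus.
Context {R : realType}.
Implicit Types U V W : normedModType R.

(** The differential is determined by its little-o expansion, which depends only on the germ;
    [diff_unique] turns the transferred expansion into equality of differentials. *)
Lemma near_eq_diff V W (f g : V -> W) x :
  (\forall y \near x, f y = g y) -> differentiable f x ->
  differentiable g x /\ 'd g x = 'd f x :> (V -> W).
Proof.
move=> fg /diff_locallyxP[dfc dfE].
have gx : g x = f x by apply/esym; exact: (nbhs_singleton fg).
have gE : g \o shift x = cst (g x) + ('d f x : V -> W) +o_ (0 : V) id.
  apply/eqaddoP => _/posnumP[e].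
  have /eqaddoP /(_ _ [gt0 of e%:num]) He : f \o shift x =
      cst (f x) + ('d f x : V -> W) +o_ (0 : V) id.
    by rewrite funeqE => y /=; rewrite dfE.
  have fg' : \forall y \near (0 : V), f (y + x) = g (y + x).
    by move: fg; rewrite (near_shift 0 x); apply: filterS => y /=; rewrite subr0.
  by apply: filterS2 fg' He => y; rewrite !fctE /= gx => ->.
have dE : 'd g x = 'd f x :> (V -> W) by apply: diff_unique.
split; last exact: dE.
by apply/diff_locallyP; split; rewrite dE; [exact: dfc | exact: gE].
Qed.

Lemma Ck_continuous V W k O (f : V -> W) x :
  Ck_on k O f -> O x -> {for x, continuous f}.
Proof.
case: k => [|k] /=; first by move=> fc; exact: fc.
by case=> df _ Ox; apply/differentiable_continuous/df.
Qed.

Lemma Ck_diff V W k O (f : V -> W) x :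
  Ck_on k.+1 O f -> O x -> differentiable f x.
Proof. by case=> df _; apply: df. Qed.

Lemma Ck_derive V W k O (f : V -> W) v : Ck_on k.+1 O f -> Ck_on k O ('D_v f).
Proof. by case=> _; apply. Qed.

Lemma Ck_le V W k O (f : V -> W) : Ck_on k.+1 O f -> Ck_on k O f.
Proof.
elim: k f => [|k IH] f; first by move=> Hf x Ox; exact: (Ck_continuous Hf Ox).
by case=> df Df; split=> // v; apply: IH.
Qed.

Lemma Ck_sub V W k (O O' : set V) (f : V -> W) :
  O' `<=` O -> Ck_on k O f -> Ck_on k O' f.
Proof.
move=> sub; elim: k f => [|k IH] f; first by move=> Hf x /sub; apply: Hf.
by case=> df Df; split=> [x /sub|v]; [exact: df | exact: IH (Df v)].
Qed.

Lemma Ck_eq V W k O (f g : V -> W) : open O -> {in O, f =1 g} ->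
  Ck_on k O f -> Ck_on k O g.
Proof.
move=> oO; elim: k f g => [|k IH] f g fg.
  move=> Hf x Ox; have fx := Hf x Ox.
  rewrite /prop_for /continuous_at -fg ?inE//.
  apply: cvg_trans fx; apply: near_eq_cvg.
  by apply: filterS (open_nbhs_nbhs (conj oO Ox)) => y Oy; rewrite fg ?inE.
have nfg x : O x -> \forall y \near x, f y = g y.
  by move=> Ox; apply: filterS (open_nbhs_nbhs (conj oO Ox)) => y Oy; rewrite fg ?inE.
case=> df Df; split=> [x Ox|v]; first by have [] := near_eq_diff (nfg x Ox) (df x Ox).
by apply: IH (Df v) => x; rewrite inE => Ox; apply/near_eq_derive/nfg.
Qed.

Lemma Ck_cst V W k O (a : W) : Ck_on k O (cst a : V -> W).
Proof.
elim: k a => [|k IH] a /=; first by move=> x _; apply: cvg_cst.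
split=> [x _|v]; first exact: differentiable_cst.
suff -> : 'D_v (cst a : V -> W) = cst 0 by apply: IH.
by rewrite funeqE => x; rewrite derive_cst.
Qed.

Lemma diff_compE U V W (f : U -> V) (g : V -> W) x v :
  differentiable f x -> differentiable g (f x) ->
  'd (g \o f) x v = 'd g (f x) ('d f x v).
Proof. by move=> df dg; rewrite (diff_comp df dg). Qed.

Lemma near_eq_diffE V W (f g : V -> W) x v :
  (\forall y \near x, f y = g y) -> differentiable f x -> 'd g x v = 'd f x v.
Proof. by move=> fg df; have [_ e] := near_eq_diff fg df; rewrite e. Qed.

Lemma diff_cstE V W (a : W) (x v : V) : 'd (fun=> a) x v = 0.
Proof. by have := congr1 (@^~ v) (@diff_cst R V W a x). Qed.

Lemma near_cst_diffE V W (f : V -> W) (a : W) x v :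
  (\forall y \near x, f y = a) -> 'd f x v = 0.
Proof.
move=> fa; rewrite (@near_eq_diffE _ _ (cst a)); first by rewrite diff_cst.
  by apply: filterS fa => y ->.
exact: differentiable_cst.
Qed.

Lemma diff_near_comp U V W (f : U -> V) (g : V -> W) (h : U -> W) x y v :
  (\forall z \near x, g (f z) = h z) -> f x = y ->
  differentiable f x -> differentiable g y -> 'd h x v = 'd g y ('d f x v).
Proof.
move=> gh <- df dg; rewrite -(diff_compE v df dg).
exact: near_eq_diffE gh (differentiable_comp df dg).
Qed.

Lemma diff_linE V W (l : {linear V -> W}) x v : continuous l -> 'd l x v = l v.
Proof. by move=> lc; rewrite (diff_lin x lc). Qed.

Lemma Ck_linear U V W k O (l : {linear V -> W}) (f : U -> V) :
  continuous l -> open O -> Ck_on k O f -> Ck_on k O (l \o f).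
Proof.
move=> lc oO; elim: k f => [|k IH] f.
  by move=> Hf x Ox; apply: continuous_comp; [apply: Hf | apply: lc].
case=> df Df; split=> [x Ox|v].
  by apply: differentiable_comp; [apply: df | apply: linear_differentiable].
apply: Ck_eq (IH _ (Df v)) => // x; rewrite inE => Ox /=.
have dfx := df x Ox; have dl := @linear_differentiable _ _ _ l (f x) lc.
have dlf := differentiable_comp dfx dl.
by rewrite (deriveE _ dlf) (deriveE _ dfx) (diff_compE _ dfx dl) diff_linE.
Qed.

Lemma Ck_add V W k O (f g : V -> W) :
  open O -> Ck_on k O f -> Ck_on k O g -> Ck_on k O (fun x => f x + g x).
Proof.
move=> oO; elim: k f g => [|k IH] f g.
  by move=> Hf Hg x Ox; apply: cvgD; [apply: Hf | apply: Hg].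
case=> df Df [dg Dg]; split=> [x Ox|v].
  exact: (differentiableD (df x Ox) (dg x Ox)).
apply: Ck_eq (IH _ _ (Df v) (Dg v)) => // x; rewrite inE => Ox /=.
exact/esym/(deriveD (diff_derivable (df x Ox)) (diff_derivable (dg x Ox))).
Qed.

(** The common source of the product rules used later, for scaling, for matrix products and for the
    Lorentz product. *)
Lemma diff_bilin_comp U V V' W (b : {bilinear V -> V' -> W})
    (f : U -> V) (g : U -> V') x :
  continuous (fun p : V * V' => b p.1 p.2) ->
  differentiable f x -> differentiable g x ->
  differentiable (fun y => b (f y) (g y)) x /\
  forall v, 'd (fun y => b (f y) (g y)) x v = b ('d f x v) (g x) + b (f x) ('d g x v).
Proof.
move=> bc df dg.
have dp := differentiable_pair df dg.
have db := differentiable_bilin (f x, g x) bc.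
have -> : (fun y => b (f y) (g y)) = (fun p => b p.1 p.2) \o (fun y => (f y, g y)) by [].
split; first exact: (differentiable_comp dp db).
move=> v; rewrite (diff_compE _ dp db) (diff_bilin (f x, g x) bc) (diff_pair df dg).
by rewrite /= addrC.
Qed.

Lemma Ck_bilin U V V' W (b : {bilinear V -> V' -> W}) k O
    (f : U -> V) (g : U -> V') :
  continuous (fun p : V * V' => b p.1 p.2) -> open O ->
  Ck_on k O f -> Ck_on k O g -> Ck_on k O (fun y => b (f y) (g y)).
Proof.
move=> bc oO; elim: k f g => [|k IH] f g.
  move=> Hf Hg x Ox.
  apply: (@continuous_comp _ _ _ (fun y => (f y, g y)) (fun p => b p.1 p.2)).
    by apply: cvg_pair; [apply: Hf | apply: Hg].
  exact: bc.
move=> Hf Hg; have [df Df] := Hf; have [dg Dg] := Hg.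
split=> [x Ox|v]; first by have [] := diff_bilin_comp bc (df x Ox) (dg x Ox).
apply: Ck_eq (Ck_add oO (IH _ _ (Df v) (Ck_le Hg)) (IH _ _ (Ck_le Hf) (Dg v))) => //.
move=> x; rewrite inE => Ox /=.
have [d1 d2] := diff_bilin_comp bc (df x Ox) (dg x Ox).
by rewrite (deriveE _ d1) (deriveE _ (df x Ox)) (deriveE _ (dg x Ox)) d2.
Qed.

Lemma scale_bilinear V : bilinear_for
    (GRing.Scale.Law.clone _ _ *:%R _) (GRing.Scale.Law.clone _ _ *:%R _)
    (@GRing.scale R V : R^o -> V -> V).
Proof.
by split=> [v a x y|a b x y] /=; rewrite ?scalerDl ?scalerDr ?scalerA // mulrC.
Qed.
HB.instance Definition _ V := bilinear_isBilinear.Build R R^o V V _ _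
  (@GRing.scale R V : R^o -> V -> V) (@scale_bilinear V).

Lemma Ck_scale V W k O (f : V -> R^o) (g : V -> W) : open O ->
  Ck_on k O f -> Ck_on k O g -> Ck_on k O (fun x => f x *: g x).
Proof.
by apply: (@Ck_bilin _ _ _ _ (@GRing.scale R W : R^o -> W -> W)); apply: scale_continuous.
Qed.

End CkCalculus.

(** * The chain rule in finite dimension and smooth matrix operations *)

Section SmoothCalculus.
Context {R : realType}.
Implicit Types U V W : normedModType R.

(** [Ck_on] differentiates along constant directions only. In a composition the inner derivative is
    a direction that varies with the point, and a finite expansion in fixed vectors with continuous
    coordinates reduces it to constant ones. *)
Definition fin_dim V := exists (I : finType) (c : I -> {linear V -> R^o}) (e : I -> V),
  (forall i, continuous (c i)) /\ forall v, v = \sum_i c i v *: e i.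

Lemma Ck_sum V W k O (I : Type) (r : seq I) (f : I -> V -> W) : open O ->
  (forall i, Ck_on k O (f i)) -> Ck_on k O (fun x => \sum_(i <- r) f i x).
Proof.
move=> oO fC; elim: r => [|i r IH].
  by apply: Ck_eq (Ck_cst _ _ 0) => // x _; rewrite big_nil.
by apply: Ck_eq (Ck_add oO (fC i) IH) => // x _; rewrite big_cons.
Qed.

Lemma Ck_comp U V W k (O : set U) (O' : set V) (f : U -> V) (g : V -> W) :
  fin_dim V -> open O -> open O' -> (forall x, O x -> O' (f x)) ->
  Ck_on k O f -> Ck_on k O' g -> Ck_on k O (g \o f).
Proof.
move=> [I [c [e [cc ce]]]] oO oO' fO; elim: k g => [|k IH] g.
  move=> Hf Hg x Ox; apply: continuous_comp; first exact: Hf.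
  exact: Hg (fO _ Ox).
move=> Hf [dg Dg]; have [df Df] := Hf.
split=> [x Ox|v].
  exact: (differentiable_comp (df x Ox) (dg _ (fO _ Ox))).
(* The chain rule with the inner derivative expanded in the vectors [e i]. Each factor is C^k: the
   first is linear in ['D_v f], the second is covered by the induction hypothesis for
   ['D_(e i) g]. *)
have H : Ck_on k O (fun x => \sum_i (c i \o 'D_v f) x *: ('D_(e i) g \o f) x).
  apply: Ck_sum => // i; apply: Ck_scale => //; first exact: Ck_linear (cc i) oO (Df v).
  exact: IH (Ck_le Hf) (Dg _).
apply: Ck_eq H => // x; rewrite inE => Ox /=.
have dfx := df x Ox; have dgx := dg _ (fO _ Ox).
rewrite (deriveE _ (differentiable_comp dfx dgx)) (diff_compE _ dfx dgx).
rewrite [in RHS](ce ('d f x v)) linear_sum; apply: eq_bigr => i _.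
by rewrite linearZ /= (deriveE _ dfx) (deriveE _ dgx).
Qed.

(** The derivative - f^-2 D_v f contains f^-1 again, so the induction raises the order of f^-1 only,
    while f itself is given with all orders. *)
Lemma Ck_inv V k O (f : V -> R^o) : open O -> (forall x, O x -> f x != 0) ->
  (forall j, Ck_on j O f) -> Ck_on k O (fun x => (f x)^-1 : R^o).
Proof.
move=> oO f0 Cf; elim: k => [|k IH].
  move=> x Ox; apply: (@cvgV R _ (nbhs x)); [exact: f0 | exact: (Cf 0%N)].
split=> [x Ox|v]; first exact: differentiableV (Ck_diff (Cf 1%N) Ox) (f0 _ Ox).
have H : Ck_on k O (fun x => ((f x)^-1 : R^o) *: (((f x)^-1 : R^o) *: (-1 *: 'D_v f x))).
  apply: Ck_scale => //; apply: Ck_scale => //.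
  by apply: Ck_scale => //; [exact: Ck_cst | exact: Ck_derive (Cf k.+1)].
apply: Ck_eq H => // x; rewrite inE => Ox.
have dfx := Ck_diff (Cf 1%N) Ox; have fx0 := f0 _ Ox.
rewrite [RHS](deriveE _ (differentiableV dfx fx0)).
rewrite (diffV dfx fx0) /= (deriveE _ dfx) /GRing.scale /= expr2 invfM.
by rewrite mulN1r !mulrN !mulNr mulrA.
Qed.

Lemma fin_dim_mx m n : fin_dim 'M[R]_(m, n).
Proof.
have lin (i : 'I_m * 'I_n) : linear (fun A : 'M[R]_(m, n) => A i.1 i.2 : R^o).
  by move=> a A B; rewrite !mxE.
pose c (i : 'I_m * 'I_n) : {linear 'M[R]_(m, n) -> R^o} :=
  HB.pack (fun A : 'M[R]_(m, n) => A i.1 i.2 : R^o)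
    (GRing.isLinear.Build _ _ _ _ _ (lin i)).
exists ('I_m * 'I_n)%type, c, (fun i => delta_mx i.1 i.2).
split=> [i|A]; first exact: coord_continuous.
by rewrite [LHS]matrix_sum_delta pair_big.
Qed.

Lemma pairD V W (v v' : V) (w w' : W) :
  (v, w) + (v', w') = (v + v', w + w') :> V * W.
Proof. by []. Qed.

Lemma pairZ V W (a : R) (v : V) (w : W) :
  a *: ((v, w) : V * W) = (a *: v, a *: w).
Proof. by []. Qed.

Lemma fin_dim_pair V W : fin_dim V -> fin_dim W -> fin_dim (V * W)%type.
Proof.
move=> [I [c [e [cc ce]]]] [J [c' [e' [cc' ce']]]].
pose F (i : I + J) (p : V * W) : R^o :=
  match i with inl i => c i p.1 | inr j => c' j p.2 end.
have lin i : linear (F i) by case: i => i a p q; rewrite /F /= linearP.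
pose C i : {linear (V * W)%type -> R^o} :=
  HB.pack (F i) (GRing.isLinear.Build _ _ _ _ _ (lin i)).
exists (I + J)%type, C,
  (fun i => match i with inl i => (e i, 0) | inr j => (0, e' j) end).
split=> [[i|j] x|[v w]].
- by apply: (@continuous_comp _ _ _ fst (c i)); [exact: cvg_fst | exact: cc].
- by apply: (@continuous_comp _ _ _ snd (c' j)); [exact: cvg_snd | exact: cc'].
rewrite big_sumType /=.
rewrite (eq_bigr (fun i => (c i v *: e i, 0))); last first.
  by move=> i _; rewrite pairZ scaler0.
rewrite [X in _ + X](eq_bigr (fun i => (0, c' i w *: e' i))); last first.
  by move=> i _; rewrite pairZ scaler0.
have s1 (f : I -> V) : \sum_i (f i, 0 : W) = (\sum_i f i, 0).
  by elim/big_rec2: _ => // i x y _ ->; rewrite pairD addr0.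
have s2 (f : J -> W) : \sum_i (0 : V, f i) = (0, \sum_i f i).
  by elim/big_rec2: _ => // i x y _ ->; rewrite pairD addr0.
by rewrite s1 s2 pairD addr0 add0r -ce -ce'.
Qed.

Lemma smooth_at_near_eq V W (f g : V -> W) x :
  (\forall y \near x, f y = g y) -> smooth_at f x -> smooth_at g x.
Proof.
move=> fg0; have /nbhs_interior fg : nbhs x [set y | f y = g y] by exact: fg0.
move=> [A [oA Ax fC]].
exists (A `&` interior [set y | f y = g y]); split.
- by apply: openI => //; exact: open_interior.
- by split => //; exact: nbhs_singleton fg.
move=> k; apply: Ck_eq (Ck_sub _ (fC k)).
- by apply: openI => //; exact: open_interior.
- by move=> y; rewrite inE => -[_ /interior_subset].
by move=> y [].
Qed.

Lemma smooth_at_ext V W (f g : V -> W) x : f =1 g -> smooth_at f x -> smooth_at g x.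
Proof. by move=> /funext ->. Qed.

Lemma smooth_at_near V W (f : V -> W) x :
  smooth_at f x -> \forall y \near x, smooth_at f y.
Proof.
move=> [A [oA Ax fC]]; apply: filterS (open_nbhs_nbhs (conj oA Ax)) => y Oy.
by exists A.
Qed.

Lemma smooth_at_diff V W (f : V -> W) x : smooth_at f x -> differentiable f x.
Proof. by move=> [A [oA Ax fC]]; exact: Ck_diff (fC 1%N) Ax. Qed.

Lemma smooth_at_continuous V W (f : V -> W) x :
  smooth_at f x -> {for x, continuous f}.
Proof. by move/smooth_at_diff/differentiable_continuous. Qed.

Lemma smooth_at_derive V W (f : V -> W) x v :
  smooth_at f x -> smooth_at ('D_v f) x.
Proof. by move=> [A [oA Ax fC]]; exists A; split=> // k; apply: Ck_derive (fC k.+1). Qed.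

Lemma smooth_at_cst V W (a : W) (x : V) : smooth_at (fun=> a) x.
Proof. by exists setT; split=> [||k] //; [exact: openT | exact: Ck_cst]. Qed.

Lemma smooth_at_linear U V W (l : {linear V -> W}) (f : U -> V) x :
  continuous l -> smooth_at f x -> smooth_at (l \o f) x.
Proof.
by move=> lc [A [oA Ax fC]]; exists A; split=> // k; apply: Ck_linear.
Qed.

Lemma smooth_at_id V (x : V) : smooth_at id x.
Proof.
exists setT; split=> [||k] //; first exact: openT.
case: k => [|k] /=; first by move=> y _; apply: cvg_id.
split=> [y _|v]; first exact: ex_diff.
apply: Ck_eq (Ck_cst k setT v); first exact: openT.
by move=> y _; rewrite derive_id.
Qed.

Lemma smooth_at_bilin U V V' W (b : {bilinear V -> V' -> W})
    (f : U -> V) (g : U -> V') x :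
  continuous (fun p : V * V' => b p.1 p.2) ->
  smooth_at f x -> smooth_at g x -> smooth_at (fun y => b (f y) (g y)) x.
Proof.
move=> bc [A [oA Ax fC]] [A' [oA' Ax' gC]].
have oI : open (A `&` A') by apply: openI.
exists (A `&` A'); split=> // k.
by apply: Ck_bilin => //; [apply: Ck_sub (fC k) | apply: Ck_sub (gC k)] => y [].
Qed.

Lemma smooth_at_add V W (f g : V -> W) x :
  smooth_at f x -> smooth_at g x -> smooth_at (fun y => f y + g y) x.
Proof.
move=> [A [oA Ax fC]] [A' [oA' Ax' gC]].
have oI : open (A `&` A') by apply: openI.
exists (A `&` A'); split=> // k.
by apply: Ck_add => //; [apply: Ck_sub (fC k) | apply: Ck_sub (gC k)] => y [].
Qed.

Lemma smooth_at_scale V W (f : V -> R^o) (g : V -> W) x :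
  smooth_at f x -> smooth_at g x -> smooth_at (fun y => f y *: g y) x.
Proof.
by apply: (@smooth_at_bilin _ _ _ _ (@GRing.scale R W : R^o -> W -> W)); apply: scale_continuous.
Qed.

Lemma smooth_at_mul V (f g : V -> R^o) x :
  smooth_at f x -> smooth_at g x -> smooth_at (fun y => f y * g y : R^o) x.
Proof. exact: smooth_at_scale. Qed.

Lemma smooth_at_opp V W (f : V -> W) x :
  smooth_at f x -> smooth_at (fun y => - f y) x.
Proof.
move=> fC; apply: smooth_at_ext (smooth_at_scale (@smooth_at_cst V R^o (-1) x) fC).
by move=> y; rewrite scaleN1r.
Qed.

Lemma smooth_at_sub V W (f g : V -> W) x :
  smooth_at f x -> smooth_at g x -> smooth_at (fun y => f y - g y) x.
Proof. by move=> fC gC; apply: smooth_at_add => //; exact: smooth_at_opp. Qed.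

Lemma smooth_at_sum V W (I : Type) (r : seq I) (f : I -> V -> W) x :
  (forall i, smooth_at (f i) x) -> smooth_at (fun y => \sum_(i <- r) f i y) x.
Proof.
move=> fC; elim: r => [|i r IH].
  by apply: smooth_at_ext (@smooth_at_cst V W 0 x); move=> y; rewrite big_nil.
by apply: smooth_at_ext (smooth_at_add (fC i) IH); move=> y; rewrite big_cons.
Qed.

Lemma smooth_at_prod V (I : Type) (r : seq I) (f : I -> V -> R^o) x :
  (forall i, smooth_at (f i) x) -> smooth_at (fun y => \prod_(i <- r) f i y : R^o) x.
Proof.
move=> fC; elim: r => [|i r IH].
  by apply: smooth_at_ext (@smooth_at_cst V R^o 1 x); move=> y; rewrite big_nil.
by apply: smooth_at_ext (smooth_at_mul (fC i) IH); move=> y; rewrite big_cons.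
Qed.

Lemma smooth_at_comp U V W (f : U -> V) (g : V -> W) x : fin_dim V ->
  smooth_at f x -> smooth_at g (f x) -> smooth_at (g \o f) x.
Proof.
move=> fV fx; have fc := smooth_at_continuous fx.
move: fx => [A [oA Ax fC]] [A' [oA' Ax' gC]].
have nx : nbhs x (A `&` f @^-1` A').
  apply: filterI; first exact: open_nbhs_nbhs.
  by apply: fc; exact: open_nbhs_nbhs.
have sub : interior (A `&` f @^-1` A') `<=` A `&` f @^-1` A' by apply: interior_subset.
have oI := open_interior (A `&` f @^-1` A').
exists (interior (A `&` f @^-1` A')); split=> // k.
apply: Ck_comp (gC k) => //; first by move=> y /sub [].
by apply: Ck_sub (fC k) => y /sub [].
Qed.

Lemma smooth_at_neq0 V (f : V -> R^o) x :
  smooth_at f x -> f x != 0 -> nbhs x [set y | f y != 0].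
Proof.
move=> /smooth_at_continuous fc fx0.
by apply: (fc [set z | z != 0]); apply: open_nbhs_nbhs; split => //; exact: open_neq.
Qed.

Lemma smooth_at_inv V (f : V -> R^o) x :
  smooth_at f x -> f x != 0 -> smooth_at (fun y => (f y)^-1 : R^o) x.
Proof.
move=> fx fx0; move: (fx) => [A [oA Ax fC]].
have nx : nbhs x (A `&` [set y | f y != 0]).
  apply: filterI; first exact: open_nbhs_nbhs.
  exact: smooth_at_neq0 fx fx0.
have sub : interior (A `&` [set y | f y != 0]) `<=` A `&` [set y | f y != 0].
  exact: interior_subset.
have oI := open_interior (A `&` [set y | f y != 0]).
exists (interior (A `&` [set y | f y != 0])); split=> // k.
apply: Ck_inv => // [y /sub []//|j].
by apply: Ck_sub (fC j) => y /sub [].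
Qed.

Lemma smooth_at_pair U V W (f : U -> V) (g : U -> W) x :
  smooth_at f x -> smooth_at g x -> smooth_at (fun y => (f y, g y)) x.
Proof.
have c1 : linear (fun v : V => (v, 0 : W)).
  by move=> a v w; rewrite pairZ pairD scaler0 addr0.
have c2 : linear (fun w : W => (0 : V, w)).
  by move=> a v w; rewrite pairZ pairD scaler0 addr0.
pose l1 : {linear V -> (V * W)%type} := HB.pack (fun v : V => (v, 0 : W))
  (GRing.isLinear.Build _ _ _ _ _ c1).
pose l2 : {linear W -> (V * W)%type} := HB.pack (fun w : W => (0 : V, w))
  (GRing.isLinear.Build _ _ _ _ _ c2).
move=> fC gC.
have l1c : continuous l1 by move=> y; apply: cvg_pair; [exact: cvg_id | exact: cvg_cst].
have l2c : continuous l2 by move=> y; apply: cvg_pair; [exact: cvg_cst | exact: cvg_id].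
apply: smooth_at_ext (smooth_at_add (smooth_at_linear l1c fC) (smooth_at_linear l2c gC)).
by move=> y; rewrite /= pairD addr0 add0r.
Qed.

(** Smooth dependence of a differential on both its base point and a moving direction, needed for
    the differential of a map as a form in its own right. *)
Lemma smooth_at_diff_dir V W (f w : V -> _) x : fin_dim V ->
  smooth_at (f : V -> W) x -> smooth_at (w : V -> V) x ->
  smooth_at (fun y => 'd f y (w y)) x.
Proof.
move=> [I [c [e [cc ce]]]] fC wC.
have H : smooth_at (fun y => \sum_i (c i \o w) y *: 'D_(e i) f y) x.
  apply: smooth_at_sum => i; apply: smooth_at_scale; last exact: smooth_at_derive.
  exact: smooth_at_linear.
apply: smooth_at_near_eq H; apply: filterS (smooth_at_near fC) => y fy.
rewrite [in RHS](ce (w y)) linear_sum; apply: eq_bigr => i _.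
by rewrite linearZ /= (deriveE _ (smooth_at_diff fy)).
Qed.

Lemma smooth_at_coord V m n (f : V -> 'M[R]_(m, n)) x i j :
  smooth_at f x -> smooth_at (fun y => f y i j : R^o) x.
Proof.
have lin : linear (fun A : 'M[R]_(m, n) => A i j : R^o) by move=> a A B; rewrite !mxE.
pose c : {linear 'M[R]_(m, n) -> R^o} :=
  HB.pack (fun A : 'M[R]_(m, n) => A i j : R^o) (GRing.isLinear.Build _ _ _ _ _ lin).
by apply: (@smooth_at_linear _ _ _ c); exact: coord_continuous.
Qed.

Lemma smooth_at_mx V m n (f : V -> 'M[R]_(m, n)) x :
  (forall i j, smooth_at (fun y => f y i j : R^o) x) -> smooth_at f x.
Proof.
move=> fC.
have H : smooth_at (fun y => \sum_i \sum_j (f y i j : R^o) *: (delta_mx i j : 'M[R]_(m, n))) x.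
  apply: smooth_at_sum => i; apply: smooth_at_sum => j.
  by apply: smooth_at_scale => //; exact: smooth_at_cst.
by apply: smooth_at_ext H; move=> y; rewrite -matrix_sum_delta.
Qed.

Lemma mulmx_continuous m n p :
  continuous (fun q : 'M[R]_(m, n) * 'M[R]_(n, p) => q.1 *m q.2).
Proof.
move=> q; apply: (@smooth_at_continuous _ _ (fun q : 'M[R]_(m, n) * 'M[R]_(n, p) => q.1 *m q.2)).
have f1 : smooth_at (fun q : 'M[R]_(m, n) * 'M[R]_(n, p) => q.1) q.
  by apply: (@smooth_at_linear _ _ _ fst id); [move=> ?; exact: cvg_fst | exact: smooth_at_id].
have f2 : smooth_at (fun q : 'M[R]_(m, n) * 'M[R]_(n, p) => q.2) q.
  by apply: (@smooth_at_linear _ _ _ snd id); [move=> ?; exact: cvg_snd | exact: smooth_at_id].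
apply: smooth_at_mx => i j.
have H : smooth_at (fun q : 'M[R]_(m, n) * 'M[R]_(n, p) => \sum_k (q.1 i k * q.2 k j) : R^o) q.
  by apply: smooth_at_sum => k; apply: smooth_at_mul; exact: smooth_at_coord.
by apply: smooth_at_ext H; move=> y; rewrite mxE.
Qed.

Lemma smooth_at_mulmx V m n p (f : V -> 'M[R]_(m, n)) (g : V -> 'M[R]_(n, p)) x :
  smooth_at f x -> smooth_at g x -> smooth_at (fun y => f y *m g y) x.
Proof. apply: (@smooth_at_bilin _ _ _ _ (@mulmx R m n p)); exact: mulmx_continuous. Qed.

Lemma diff_mulmx V m n p (f : V -> 'M[R]_(m, n)) (g : V -> 'M[R]_(n, p)) x v a b :
  differentiable f x -> differentiable g x -> 'd f x v = a -> 'd g x v = b ->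
  'd (fun y => f y *m g y) x v = a *m g x + f x *m b.
Proof.
move=> df dg <- <-.
by have [_ ->] := diff_bilin_comp (b := @mulmx R m n p) (@mulmx_continuous m n p) df dg.
Qed.

Lemma diff_mulmxl V m n p (A : 'M[R]_(m, n)) (f : V -> 'M[R]_(n, p)) x v :
  differentiable f x ->
  differentiable (fun y => A *m f y) x /\ 'd (fun y => A *m f y) x v = A *m 'd f x v.
Proof.
move=> df; have dc := @differentiable_cst R V _ A x.
have [H1 H2] := diff_bilin_comp (b := @mulmx R m n p) (@mulmx_continuous m n p) dc df.
by split; [exact: H1 | rewrite (H2 v) diff_cst /= mul0mx add0r].
Qed.

Lemma diff_mulmxr V m n p (A : 'M[R]_(n, p)) (f : V -> 'M[R]_(m, n)) x v :
  differentiable f x ->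
  differentiable (fun y => f y *m A) x /\ 'd (fun y => f y *m A) x v = 'd f x v *m A.
Proof.
move=> df; have dc := @differentiable_cst R V _ A x.
have [H1 H2] := diff_bilin_comp (b := @mulmx R m n p) (@mulmx_continuous m n p) df dc.
by split; [exact: H1 | rewrite (H2 v) diff_cst /= mulmx0 addr0].
Qed.

Lemma trmx_continuous m n : continuous (@trmx R m n).
Proof.
move=> q; apply: (@smooth_at_continuous _ _ (@trmx R m n)); apply: smooth_at_mx => i j.
apply: smooth_at_ext (@smooth_at_coord _ _ _ id q j i (smooth_at_id q)).
by move=> y; rewrite mxE.
Qed.

Lemma smooth_at_trmx V m n (f : V -> 'M[R]_(m, n)) x :
  smooth_at f x -> smooth_at (fun y => (f y)^T) x.
Proof. apply: (@smooth_at_linear _ _ _ (@trmx R m n)); exact: trmx_continuous. Qed.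

Lemma diff_trmx V m n (f : V -> 'M[R]_(m, n)) x v : differentiable f x ->
  differentiable (fun y => (f y)^T) x /\ 'd (fun y => (f y)^T) x v = ('d f x v)^T.
Proof.
move=> df; have tc := @trmx_continuous m n.
have dt := @linear_differentiable _ _ _ (@trmx R m n) (f x) tc.
split; first exact: (differentiable_comp df dt).
by rewrite (diff_compE v df dt) (diff_linE _ _ tc).
Qed.

Lemma smooth_at_det V n (f : V -> 'M[R]_n) x :
  smooth_at f x -> smooth_at (fun y => \det (f y) : R^o) x.
Proof.
move=> fC; rewrite /determinant; apply: smooth_at_sum => s.
apply: smooth_at_mul; first exact: smooth_at_cst.
by apply: smooth_at_prod => i; exact: smooth_at_coord.
Qed.

Lemma smooth_at_invmx V n (f : V -> 'M[R]_n) x :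
  smooth_at f x -> f x \in unitmx -> smooth_at (fun y => invmx (f y)) x.
Proof.
move=> fC fx; have dC := smooth_at_det fC.
have d0 : \det (f x) != 0 by move: fx; rewrite unitmxE unitfE.
(* Cramer's formula. It agrees with [invmx] where the determinant is non-zero, hence on a
   neighbourhood of x. *)
have H : smooth_at (fun y => ((\det (f y))^-1 : R^o) *: \adj (f y)) x.
  apply: smooth_at_scale; first exact: smooth_at_inv.
  apply: smooth_at_mx => i j.
  have H : smooth_at (fun y => cofactor (f y) j i : R^o) x.
    rewrite /cofactor; apply: smooth_at_mul; first exact: smooth_at_cst.
    apply: smooth_at_det; apply: smooth_at_mx => k l.
    apply: smooth_at_ext (smooth_at_coord (lift j k) (lift i l) fC).
    by move=> y; rewrite !mxE.
  by apply: smooth_at_ext H; move=> y; rewrite mxE.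
apply: smooth_at_near_eq H.
have dn : nbhs x [set y | \det (f y) != 0].
  exact: smooth_at_neq0 dC d0.
by apply: filterS dn => y dy; rewrite /invmx unitmxE unitfE dy.
Qed.

End SmoothCalculus.

Lemma lin0 (R : pzRingType) (V W : lmodType R) (f : V -> W) : linear f -> f 0 = 0.
Proof. by move=> fl; have := fl (-1) 0 0; rewrite scaler0 addr0 scaleN1r addNr. Qed.

(** * Smooth functions and forms on manifolds *)

Section Charts.
Context {R : realType} {n : nat} {M : manifold R n}.
Implicit Types x y : M.

Lemma near_cdom x y : cdom x y -> \forall y' \near y, cdom x y'.
Proof. by move=> xy; apply: open_nbhs_nbhs; split=> //; exact: cdom_open. Qed.

Lemma near_chart x y : cdom x y ->
  \forall z \near cmap x y, cdom x (cinv x z) /\ cmap x (cinv x z) = z.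
Proof.
move=> xy.
have : nbhs (cmap x y) (cmap x @` cdom x).
  by apply: open_nbhs_nbhs; split; [exact: cmap_open | exists y].
by apply: filterS => z [y' xy' <-]; rewrite cmapK.
Qed.

Lemma near_cinv x y (Q : M -> Prop) : cdom x y ->
  (\forall y' \near y, Q y') -> \forall z \near cmap x y, Q (cinv x z).
Proof.
move=> xy Qy; have := @cinv_continuous _ _ M x y xy; rewrite /prop_for /continuous_at.
by rewrite cmapK //; apply.
Qed.

Lemma near_cmap x y (Q : 'rV[R]_n -> Prop) : cdom x y ->
  (\forall z \near cmap x y, Q z) -> \forall y' \near y, Q (cmap x y').
Proof. by move=> xy Qy; exact: (@cmap_continuous _ _ M x y xy). Qed.

Section Functions.
Context {E : normedModType R}.
Implicit Types f g : M -> E.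

(** Smoothness at y is defined in the chart centred at y, while a statement near x lives in the
    chart centred at x. Composing with the transition map passes between the two. *)
Lemma smooth_chart_change x x' y f : cdom x y -> cdom x' y ->
  smooth_at (f \o cinv x) (cmap x y) -> smooth_at (f \o cinv x') (cmap x' y).
Proof.
move=> xy x'y fx.
have H : smooth_at ((f \o cinv x) \o (cmap x \o cinv x')) (cmap x' y).
  apply: smooth_at_comp; [exact: fin_dim_mx | exact: transition_smooth |].
  by rewrite /= cmapK.
apply: smooth_at_near_eq H.
by apply: filterS (near_cinv x'y (near_cdom xy)) => z /= xz; rewrite cmapK.
Qed.

Lemma diff_chart_change x x' y f v : cdom x y -> cdom x' y ->
  differentiable (f \o cinv x) (cmap x y) ->
  'd (f \o cinv x) (cmap x y) ('d (cmap x \o cinv x') (cmap x' y) v)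
  = 'd (f \o cinv x') (cmap x' y) v.
Proof.
move=> xy x'y fx.
have tx := smooth_at_diff (transition_smooth x'y xy).
apply/esym/(diff_near_comp _ _ _ tx fx); last by rewrite /= cmapK.
by apply: filterS (near_cinv x'y (near_cdom xy)) => z /= xz; rewrite cmapK.
Qed.

Lemma smooth_funP x y f : cdom x y ->
  smooth_fun_at f y <-> smooth_at (f \o cinv x) (cmap x y).
Proof.
by move=> xy; split=> H; apply: smooth_chart_change H => //; exact: cdom_self.
Qed.

Lemma smooth_fun_near x f : smooth_fun_at f x -> \forall y \near x, smooth_fun_at f y.
Proof.
move=> fx; have xx := cdom_self x.
apply: filterS2 (near_cdom xx) (near_cmap xx (smooth_at_near fx)) => y xy fy.
exact: (smooth_funP f xy).2.
Qed.

Lemma smooth_fun_near_eq x f g : (\forall y \near x, f y = g y) ->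
  smooth_fun_at f x -> smooth_fun_at g x.
Proof.
by move=> fg; apply: smooth_at_near_eq; exact: near_cinv (cdom_self x) fg.
Qed.

Lemma dfun_near_eq x f g w : (\forall y \near x, f y = g y) ->
  smooth_fun_at f x -> dfun g x w = dfun f x w.
Proof.
move=> fg fx.
exact: near_eq_diffE (near_cinv (cdom_self x) fg) (smooth_at_diff fx).
Qed.

Lemma dfun_coord x y f v : cdom x y -> smooth_fun_at f y ->
  dfun f y (coord_field x v y) = 'd (f \o cinv x) (cmap x y) v.
Proof.
by move=> xy fy; apply: diff_chart_change => //; [exact: cdom_self | exact: smooth_at_diff].
Qed.

End Functions.

Section SmoothFunctionCalculus.
Context {E : normedModType R}.
Implicit Types (a b : M -> R^o) (f g : M -> E).

Lemma smooth_fun_cst (e : E) x : smooth_fun_at (fun=> e : E) x.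
Proof. exact: (@smooth_at_cst _ _ _ e). Qed.

Lemma smooth_fun_add f g x : smooth_fun_at f x -> smooth_fun_at g x ->
  smooth_fun_at (fun y => f y + g y) x.
Proof. exact: (@smooth_at_add _ _ _ (f \o cinv x) (g \o cinv x)). Qed.

Lemma smooth_fun_sub f g x : smooth_fun_at f x -> smooth_fun_at g x ->
  smooth_fun_at (fun y => f y - g y) x.
Proof. exact: (@smooth_at_sub _ _ _ (f \o cinv x) (g \o cinv x)). Qed.

Lemma smooth_fun_scale a f x : smooth_fun_at a x -> smooth_fun_at f x ->
  smooth_fun_at (fun y => a y *: f y) x.
Proof. exact: (@smooth_at_scale _ _ _ (a \o cinv x) (f \o cinv x)). Qed.

Lemma smooth_fun_sum (I : Type) (r : seq I) (F : I -> M -> E) x :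
  (forall i, smooth_fun_at (F i) x) -> smooth_fun_at (fun y => \sum_(i <- r) F i y) x.
Proof. exact: (@smooth_at_sum _ _ _ _ r (fun i => F i \o cinv x)). Qed.

Lemma smooth_fun_mul a b x : smooth_fun_at a x -> smooth_fun_at b x ->
  smooth_fun_at (fun y => a y * b y : R^o) x.
Proof. exact: (@smooth_at_mul _ _ (a \o cinv x) (b \o cinv x)). Qed.

Lemma smooth_fun_neq0 a x : smooth_fun_at a x -> a x != 0 -> \forall y \near x, a y != 0.
Proof.
move=> aS a0; have xx := cdom_self x.
have a0' : (a \o cinv x) (cmap x x) != 0 by rewrite /= cmapK.
have nd := near_cmap (Q := fun z => (a \o cinv x) z != 0) xx (smooth_at_neq0 aS a0').
by apply: filterS2 (near_cdom xx) nd => y xy /=; rewrite cmapK.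
Qed.

Context {m p q : nat}.

Lemma smooth_fun_mulmx (A : M -> 'M[R]_(m, p)) (B : M -> 'M[R]_(p, q)) x :
  smooth_fun_at A x -> smooth_fun_at B x -> smooth_fun_at (fun y => A y *m B y) x.
Proof. exact: (@smooth_at_mulmx _ _ _ _ _ (A \o cinv x) (B \o cinv x)). Qed.

Lemma smooth_fun_trmx (A : M -> 'M[R]_(m, p)) x :
  smooth_fun_at A x -> smooth_fun_at (fun y => (A y)^T) x.
Proof. exact: (@smooth_at_trmx _ _ _ _ (A \o cinv x)). Qed.

Lemma smooth_fun_coord (A : M -> 'M[R]_(m, p)) i j x :
  smooth_fun_at A x -> smooth_fun_at (fun y => A y i j : R^o) x.
Proof. exact: (@smooth_at_coord _ _ _ _ (A \o cinv x)). Qed.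

Lemma smooth_fun_mx (A : M -> 'M[R]_(m, p)) x :
  (forall i j, smooth_fun_at (fun y => A y i j : R^o) x) -> smooth_fun_at A x.
Proof. exact: (@smooth_at_mx _ _ _ _ (A \o cinv x)). Qed.

Lemma smooth_fun_det (A : M -> 'M[R]_m) x :
  smooth_fun_at A x -> smooth_fun_at (fun y => \det (A y) : R^o) x.
Proof. exact: (@smooth_at_det _ _ _ (A \o cinv x)). Qed.

Lemma smooth_fun_invmx (A : M -> 'M[R]_m) x : smooth_fun_at A x ->
  A x \in unitmx -> smooth_fun_at (fun y => invmx (A y)) x.
Proof.
move=> AS Ax; apply: (@smooth_at_invmx _ _ _ (A \o cinv x)) => //.
by rewrite /= cmapK //; exact: cdom_self.
Qed.

End SmoothFunctionCalculus.

Lemma cmap_smooth x y : cdom x y -> smooth_fun_at (cmap x : M -> 'rV[R]_n) y.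
Proof. by move=> xy; apply: transition_smooth => //; exact: cdom_self. Qed.

Lemma transition_id x y v : cdom x y -> 'd (cmap x \o cinv x) (cmap x y) v = v.
Proof.
move=> xy.
have idd := @smooth_at_diff _ _ _ _ _ (@smooth_at_id R 'rV[R]_n (cmap x y)).
rewrite (near_eq_diffE v _ idd); last first.
  by apply: filterS (near_chart xy) => z [_ /esym].
by rewrite (@diff_linE _ _ _ idfun) // => ?; exact: cvg_id.
Qed.

Lemma coord_fieldK x y v : cdom x y -> components x y (coord_field x v y) = v.
Proof.
move=> xy; rewrite /components /coord_field.
rewrite (@diff_chart_change _ y x y (cmap x)) ?transition_id //; first exact: cdom_self.
exact: smooth_at_diff (cmap_smooth xy).
Qed.

Lemma componentsK x y v : cdom x y -> coord_field x (components x y v) y = v.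
Proof.
move=> xy; have yy := cdom_self y; rewrite /components /coord_field.
rewrite (@diff_chart_change _ x y y (cmap y)) ?transition_id //.
exact: smooth_at_diff (transition_smooth xy yy).
Qed.

(** The version of [smooth_form] at a single point, suited to forms pulled back by a section that is
    smooth only near x. *)
Definition smooth_form_at {E : normedModType R} (om : M -> 'rV[R]_n -> E) x :=
  (\forall y \near x, linear (om y)) /\
  forall v, smooth_fun_at (fun y => om y (coord_field x v y)) x.

Lemma linear_sumZ (E : lmodType R) (f : 'rV[R]_n -> E) (v : 'rV[R]_n) :
  linear f -> f v = \sum_i v 0 i *: f (delta_mx 0 i).
Proof.
move=> fl; pose F : {linear 'rV[R]_n -> E} := HB.pack f (GRing.isLinear.Build _ _ _ _ _ fl).
rewrite -[f]/(F : _ -> _) {1}(row_sum_delta v) linear_sum.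
by apply: eq_bigr => i _; rewrite linearZ.
Qed.

Lemma coord_field_linear x y : linear (fun v => coord_field x v y).
Proof. by move=> a v w; rewrite /coord_field linearP. Qed.

Lemma components_linear x y : linear (components x y).
Proof. by move=> a v w; rewrite /components linearP. Qed.

Lemma form_coord (E : normedModType R) (om : M -> 'rV[R]_n -> E) x y v :
  linear (om y) ->
  om y (coord_field x v y) = \sum_i v 0 i *: om y (coord_field x (delta_mx 0 i) y).
Proof.
move=> ol; apply: (@linear_sumZ _ (fun v => om y (coord_field x v y))) => a u w.
by rewrite coord_field_linear ol.
Qed.

Lemma form_apply_coord (E : normedModType R) (om : M -> 'rV[R]_n -> E) x (V : M -> 'rV[R]_n) :
  smooth_form_at om x -> smooth_fun_at V x ->
  smooth_fun_at (fun y => om y (coord_field x (V y) y)) x.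
Proof.
move=> [ol oS] VS.
have H : smooth_fun_at (fun y => \sum_i (V y 0 i : R^o) *: om y (coord_field x (delta_mx 0 i) y)) x.
  apply: smooth_fun_sum => i; apply: smooth_fun_scale; last exact: oS.
  exact: smooth_fun_coord VS.
by apply: smooth_fun_near_eq H; apply: filterS ol => y ol; rewrite form_coord.
Qed.

Definition smooth_vfield_at (X : vfield M) x :=
  smooth_fun_at (fun y => components x y (X y)) x.

Lemma form_apply (E : normedModType R) (om : M -> 'rV[R]_n -> E) x (X : vfield M) :
  smooth_form_at om x -> smooth_vfield_at X x -> smooth_fun_at (fun y => om y (X y)) x.
Proof.
move=> oS XS; apply: smooth_fun_near_eq (form_apply_coord oS XS).
by apply: filterS (near_cdom (cdom_self x)) => y xy; rewrite componentsK.
Qed.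

Lemma dfun_form (E : normedModType R) (f : M -> E) x :
  smooth_fun_at f x -> smooth_form_at (dfun f) x.
Proof.
move=> fx; split=> [|v]; first by apply: nearW => y a v w; rewrite /dfun linearP.
have H : smooth_fun_at (fun y => 'd (f \o cinv x) (cmap x y) v) x.
  have H0 : smooth_at (fun z => 'd (f \o cinv x) z v) (cmap x x).
    by apply: smooth_at_diff_dir => //; [exact: fin_dim_mx | exact: smooth_at_cst].
  apply: smooth_at_near_eq H0.
  by apply: filterS (near_chart (cdom_self x)) => z [_ /= ->].
apply: smooth_fun_near_eq H.
apply: filterS2 (near_cdom (cdom_self x)) (smooth_fun_near fx) => y xy fy.
by rewrite dfun_coord.
Qed.

(** In the chart at x, B is multiplication by a matrix [Mt] of smooth functions. Injectivity makes
    [Mt] invertible at x, hence nearby, so the components of X are those of B X times a smooth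
    inverse matrix. This is how smoothness is brought back from values to vector fields. *)
Lemma coframe_smooth (B : M -> 'rV[R]_n -> 'rV[R]_n) x (X : vfield M) :
  smooth_form_at B x -> injective (B x) ->
  smooth_fun_at (fun y => B y (X y)) x -> smooth_vfield_at X x.
Proof.
move=> [Bl BS] Binj BX.
pose Mt y : 'M[R]_n := \matrix_i B y (coord_field x (delta_mx 0 i) y).
have BE y v : linear (B y) -> B y (coord_field x v y) = v *m Mt y.
  move=> ol; rewrite form_coord // mulmx_sum_row; apply: eq_bigr => i _.
  by rewrite rowK.
have Bx := nbhs_singleton Bl.
have xx := cdom_self x.
have Mu : Mt x \in unitmx.
  rewrite -row_free_unit -kermx_eq0; apply/rowV0P => v /sub_kermxP.
  rewrite -BE // => vM; rewrite -(coord_fieldK v xx).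
  have /Binj -> : B x (coord_field x v x) = B x 0 by rewrite vM lin0.
  by rewrite lin0 //; exact: components_linear.
have MS : smooth_fun_at Mt x.
  apply: smooth_fun_mx => i j; apply: smooth_at_ext (smooth_fun_coord 0 j (BS (delta_mx 0 i))) => z.
  by rewrite /= mxE.
have H : smooth_fun_at (fun y => B y (X y) *m invmx (Mt y)) x.
  exact: smooth_fun_mulmx BX (smooth_fun_invmx MS Mu).
apply: smooth_fun_near_eq H.
have Mn : \forall y \near x, Mt y \in unitmx.
  have d0 : \det (Mt x) != 0 by move: Mu; rewrite unitmxE unitfE.
  apply: filterS (smooth_fun_neq0 (smooth_fun_det MS) d0) => y.
  by rewrite unitmxE unitfE.
apply: filterS3 (near_cdom xx) Bl Mn => y xy Bly My.
by rewrite -{1}(componentsK (X y) xy) BE // mulmxK.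
Qed.

End Charts.

(** * Composition of smooth maps and pullback of forms *)

Section SmoothMaps.
Context {R : realType} {n k l : nat} {M : manifold R n} {M' : manifold R k} {M'' : manifold R l}.
Implicit Types (x : M) (s : M -> M').

Lemma near_map_cdom s x : {for x, continuous s} -> \forall y \near x, cdom (s x) (s y).
Proof.
by move=> sc; apply: (sc (cdom (s x))); exact: near_cdom (cdom_self _).
Qed.

Lemma smooth_fun_comp (E : normedModType R) s (f : M' -> E) x :
  smooth_map_at s x -> smooth_fun_at f (s x) ->
  smooth_fun_at (f \o s) x /\
  forall w, dfun (f \o s) x w = dfun f (s x) (tangent_map s x w).
Proof.
move=> [sc sS] fS; have xx := cdom_self x.
have e : (cmap (s x) \o s \o cinv x) (cmap x x) = cmap (s x) (s x) by rewrite /= cmapK.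
have fS' := fS; rewrite /smooth_fun_at -e in fS'.
have ne : \forall z \near cmap x x,
    ((f \o cinv (s x)) \o (cmap (s x) \o s \o cinv x)) z = ((f \o s) \o cinv x) z.
  by apply: filterS (near_cinv xx (near_map_cdom sc)) => z sz /=; rewrite cmapK.
have cS : smooth_at ((f \o cinv (s x)) \o (cmap (s x) \o s \o cinv x)) (cmap x x).
  by apply: smooth_at_comp => //; exact: fin_dim_mx.
split=> [|w]; first exact: smooth_at_near_eq ne cS.
exact: (@diff_near_comp _ _ _ _ (cmap (s x) \o s \o cinv x) (f \o cinv (s x))
  ((f \o s) \o cinv x) _ _ w ne e (smooth_at_diff sS) (smooth_at_diff fS)).
Qed.

Lemma smooth_map_comp s (p : M' -> M'') x :
  smooth_map_at s x -> smooth_map_at p (s x) ->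
  smooth_map_at (p \o s) x /\
  forall w, tangent_map (p \o s) x w = tangent_map p (s x) (tangent_map s x w).
Proof.
move=> sS [pc pS].
have [H1 H2] := @smooth_fun_comp _ s (cmap (p (s x)) \o p) x sS pS.
split=> //; split=> //; case: sS => sc _.
exact: continuous_comp.
Qed.

(** The tangent map at y is written in charts that move with y. Passing to the fixed charts at x and
    [s x] makes its smooth dependence on y visible. *)
Lemma tangent_map_coord s x y v : smooth_map_at s x -> smooth_map_at s y ->
  cdom x y -> cdom (s x) (s y) -> smooth_at (cmap (s x) \o s \o cinv x) (cmap x y) ->
  tangent_map s y (coord_field x v y)
  = coord_field (s x) ('d (cmap (s x) \o s \o cinv x) (cmap x y) v) (s y).
Proof.
move=> sx [sc sy] xy sxy Sxy; rewrite /tangent_map /coord_field.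
have yy := cdom_self y; have tt := transition_smooth sxy (cdom_self (s y)).
apply: etrans (diff_chart_change (f := cmap (s y) \o s) v yy xy (smooth_at_diff sy)) _.
have e : (cmap (s x) \o s \o cinv x) (cmap x y) = cmap (s x) (s y) by rewrite /= cmapK.
apply: (@diff_near_comp _ _ _ _ (cmap (s x) \o s \o cinv x) (cmap (s y) \o cinv (s x))
  ((cmap (s y) \o s) \o cinv x) _ _ v _ e (smooth_at_diff Sxy) (smooth_at_diff tt)).
have := sc _ (near_cdom sxy) => /(near_cinv xy).
by apply: filterS => z /= sz; rewrite cmapK.
Qed.

Lemma pullback_form (E : normedModType R) (om : M' -> 'rV[R]_k -> E) s x :
  smooth_form om -> (\forall y \near x, smooth_map_at s y) ->
  smooth_form_at (fun y w => om (s y) (tangent_map s y w)) x.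
Proof.
move=> [ol oS] sS; split=> [|v].
  by apply: nearW => y a v w; rewrite /tangent_map linearP ol.
have sx := nbhs_singleton sS; have xx := cdom_self x.
have [sc sxS] := sx.
pose V y := 'd (cmap (s x) \o s \o cinv x) (cmap x y) v.
have VS : smooth_fun_at V x.
  have H0 : smooth_at (fun z => 'd (cmap (s x) \o s \o cinv x) z v) (cmap x x).
    by apply: smooth_at_diff_dir => //; [exact: fin_dim_mx | exact: smooth_at_cst].
  apply: smooth_at_near_eq H0.
  by apply: filterS (near_chart (cdom_self x)) => z [_]; rewrite /V /= => ->.
(* The image of a coordinate field is a combination of coordinate fields of the target chart with
   smooth coefficients V, and [om] is smooth on each of those along s. *)
have H : smooth_fun_at (fun y => \sum_i (V y 0 i : R^o) *:
    om (s y) (coord_field (s x) (delta_mx 0 i) (s y))) x.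
  apply: smooth_fun_sum => i; apply: smooth_fun_scale; first exact: smooth_fun_coord VS.
  by have [] := smooth_fun_comp sx (oS (s x) (delta_mx 0 i)).
apply: smooth_fun_near_eq H.
have near3 := near_cmap xx (smooth_at_near sxS).
apply: filterS3 (near_map_cdom sc) sS (filterI (near_cdom xx) near3) => y sxy sy [xy Sxy].
by rewrite tangent_map_coord // form_coord.
Qed.

End SmoothMaps.

(** * The Lorentz model *)

Section LorentzAlgebra.
Context {R : realType} {m : nat}.
Notation L := 'cV[R]_(1 + m + 1).
Notation lvec := (@lvec R m).
Notation nvec := (@nvec R m).
Notation gram := (@gram R m).
Notation galg := (@galg R m).
Notation halg := (@halg R m).
Notation Hgrp := (@Hgrp R m).
Implicit Types (v w f : L) (k B : 'M[R]_(1 + m + 1)).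

Lemma gram_tr : gram^T = gram.
Proof.
by rewrite /gram !tr_block_mx tr_row_mx tr_col_mx !trmx0 !trmx1.
Qed.

Lemma gramK : gram *m gram = 1%:M.
Proof.
rewrite /gram mulmx_block !mul_block_col !mul_row_block !mul_col_row ?mul_row_col.
rewrite !(mul0mx, mulmx0, mul1mx, mulmx1, addr0, add0r).
have -> : col_mx 0 (row_mx 0 1%:M) = block_mx 0 0 0 1%:M :> 'M[R]_(1 + m).
  by rewrite /block_mx row_mx0.
by rewrite add_block_mx !(addr0, add0r) row_mx0 col_mx0 -!scalar_mx_block.
Qed.

Lemma lorentzC v w : lorentz v w = lorentz w v.
Proof.
rewrite /lorentz; have -> : w^T *m gram *m v = (v^T *m gram *m w)^T.
  by rewrite !trmx_mul trmxK gram_tr mulmxA.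
by rewrite [RHS]mxE.
Qed.

Lemma lorentzDl v v' w : lorentz (v + v') w = lorentz v w + lorentz v' w.
Proof. by rewrite /lorentz linearD /= !mulmxDl mxE. Qed.
Lemma lorentzZl a v w : lorentz (a *: v) w = a * lorentz v w.
Proof. by rewrite /lorentz linearZ /= -!scalemxAl mxE. Qed.
Lemma lorentzDr v w w' : lorentz v (w + w') = lorentz v w + lorentz v w'.
Proof. by rewrite /lorentz mulmxDr mxE. Qed.
Lemma lorentzZr a v w : lorentz v (a *: w) = a * lorentz v w.
Proof. by rewrite /lorentz -scalemxAr mxE. Qed.
Lemma lorentzNl v w : lorentz (- v) w = - lorentz v w.
Proof. by rewrite -scaleN1r lorentzZl mulN1r. Qed.
Lemma lorentzNr v w : lorentz v (- w) = - lorentz v w.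
Proof. by rewrite -scaleN1r lorentzZr mulN1r. Qed.
Lemma lorentz0l v : lorentz 0 v = 0.
Proof. by rewrite -(scale0r 0) lorentzZl mul0r. Qed.
Lemma lorentz_suml (I : Type) (r : seq I) (F : I -> L) w :
  lorentz (\sum_(i <- r) F i) w = \sum_(i <- r) lorentz (F i) w.
Proof.
elim: r => [|i r IH]; first by rewrite !big_nil lorentz0l.
by rewrite !big_cons lorentzDl IH.
Qed.

Definition lorentzE := (lorentzDl, lorentzZl, lorentzDr, lorentzZr, lorentzNl, lorentzNr).

Lemma lorentz_col (a b a' b' : 'M[R]_1) (X X' : 'cV[R]_m) :
  lorentz (col_mx (col_mx a X) b) (col_mx (col_mx a' X') b') =
  a 0 0 * b' 0 0 + (X^T *m X') 0 0 + b 0 0 * a' 0 0.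
Proof.
rewrite /lorentz /gram !tr_col_mx !mul_row_block mul_row_col.
rewrite !(mul0mx, mulmx0, mul1mx, mulmx1, addr0, add0r).
rewrite mul_row_col mul_mx_row mulmx1 mulmx0 add_row_mx addr0 add0r mulmx1 mul_row_col.
rewrite mulmx0 addr0; move: (X^T *m X') => P.
by rewrite !mxE !big_ord1 !mxE; ring.
Qed.

Lemma lorentz_lvec : lorentz lvec lvec = 0.
Proof. by rewrite lorentz_col mulmx0 !mxE !(mulr0, mul0r, add0r, addr0). Qed.

Definition evec (X : 'cV[R]_m) : L := col_mx (col_mx 0 X) 0.

Lemma nvecE : nvec = col_mx (col_mx 0 0) 1%:M.
Proof. by rewrite /nvec col_mx0. Qed.

Lemma vec_decomp v : exists X, v = lorentz v nvec *: lvec + evec X + lorentz v lvec *: nvec.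
Proof.
rewrite -[v]vsubmxK -[usubmx v]vsubmxK.
set a := usubmx (usubmx v); set X := dsubmx (usubmx v); set b := dsubmx v.
exists X; rewrite nvecE !lorentz_col !mulmx0 !mxE !(mulr0, mul0r, addr0, add0r, mulr1).
rewrite /evec !scale_col_mx !add_col_mx !scaler0 !(addr0, add0r).
by congr col_mx; [congr col_mx|]; apply/matrixP => i j; rewrite !ord1 !mxE mulr1.
Qed.

Lemma lorentz_evec X Y : lorentz (evec X) (evec Y) = (X^T *m Y) 0 0.
Proof. by rewrite lorentz_col !mxE !(mulr0, mul0r, add0r, addr0). Qed.
Lemma lorentz_evec_lvec X : lorentz (evec X) lvec = 0.
Proof. by rewrite lorentz_col mulmx0 !mxE !(mulr0, mul0r, add0r, addr0). Qed.
Lemma lorentz_evec_nvec X : lorentz (evec X) nvec = 0.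
Proof. by rewrite nvecE lorentz_col mulmx0 !mxE !(mulr0, add0r, mul0r, addr0). Qed.
Lemma lorentz_lvec_nvec : lorentz lvec nvec = 1.
Proof. by rewrite nvecE lorentz_col mulmx0 !mxE !(mulr0, add0r, mul0r, addr0, mulr1). Qed.
Lemma lorentz_nvec : lorentz nvec nvec = 0.
Proof. by rewrite nvecE lorentz_col mulmx0 !mxE !(mulr0, add0r, mul0r, addr0, mulr1). Qed.

Lemma evec_linear : linear evec.
Proof. by move=> a X Y; rewrite /evec !scale_col_mx !add_col_mx !scaler0 !addr0. Qed.

Lemma evec_inj : injective evec.
Proof. by move=> X Y /eq_col_mx [/eq_col_mx [_ ->]]. Qed.

Lemma lorentz_evec_ge0 X : 0 <= lorentz (evec X) (evec X) /\
  (lorentz (evec X) (evec X) = 0 -> X = 0).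
Proof.
rewrite lorentz_evec mxE; split; first by apply: sumr_ge0 => i _; rewrite mxE -expr2 sqr_ge0.
move=> /eqP; rewrite psumr_eq0; last by move=> i _; rewrite mxE -expr2 sqr_ge0.
move=> /allP H; apply/colP => i; have := H i (mem_index_enum i).
by rewrite /= !mxE -expr2 sqrf_eq0 => /eqP.
Qed.

(** This is B l for any B in [galg] with class y modulo [halg]; it realizes g/h as the hyperplane
    orthogonal to l. *)
Definition emb (y : R * 'cV[R]_m) : L := y.1 *: lvec + evec y.2.

Lemma emb_inj : injective emb.
Proof.
move=> [a X] [b Y] e; have := congr1 (lorentz^~ nvec) e.
rewrite !lorentzE !lorentz_evec_nvec lorentz_lvec_nvec !addr0 !mulr1 => /= ab.
by move: e; rewrite /emb /= ab => /addrI /evec_inj ->.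
Qed.

Lemma emb_lvec y : lorentz (emb y) lvec = 0.
Proof. by rewrite !lorentzE lorentz_lvec lorentz_evec_lvec mulr0 addr0. Qed.

Lemma lorentz_emb y z : lorentz (emb y) (emb z) = qform y z.
Proof.
rewrite !lorentzE lorentz_lvec lorentz_evec_lvec lorentzC lorentz_evec_lvec.
by rewrite lorentz_evec !(mulr0, add0r).
Qed.

Lemma embP v : lorentz v lvec = 0 -> exists y, v = emb y.
Proof.
by have [X vE] := vec_decomp v => vl; rewrite vE vl scale0r addr0; exists (lorentz v nvec, X).
Qed.

Lemma lorentz_perp_ge0 v : lorentz v lvec = 0 -> 0 <= lorentz v v.
Proof.
move=> /embP[[a X] ->]; rewrite lorentz_emb; have [] := lorentz_evec_ge0 X.
by rewrite lorentz_evec.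
Qed.

(** The Lorentz product is semidefinite on the hyperplane orthogonal to l, with radical the line of
    l; pairing with [nvec] reads off the coefficient. *)
Lemma lorentz_perp_eq0 v : lorentz v lvec = 0 -> lorentz v v = 0 ->
  v = lorentz v nvec *: lvec.
Proof.
move=> vl; have [X vE] := vec_decomp v; rewrite vl scale0r addr0 in vE.
rewrite {1 2}vE !lorentzE lorentz_lvec lorentz_evec_lvec (lorentzC _ (evec X)) lorentz_evec_lvec.
by rewrite !(mulr0, add0r) => /(lorentz_evec_ge0 X).2 X0; rewrite {1}vE X0 (lin0 evec_linear) addr0.
Qed.

Lemma galg_skew B : galg B -> B^T *m gram = - (gram *m B).
Proof.
move=> [a [X [z [A [Ask ->]]]]]; rewrite /gmx /gram.
rewrite !(tr_block_mx, tr_col_mx, tr_row_mx) !mulmx_block.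
rewrite !(mul_block_col, mul_row_block, mul_col_row, mul_row_col, mulmx_block,
  mul_mx_row, mul_col_mx).
have trN p q (D : 'M[R]_(p, q)) : (- D)^T = - D^T by rewrite linearN.
rewrite !(trmx0, trN, trmxK, tr_scalar_mx, mul0mx, mulmx0, mul1mx, mulmx1, addr0, add0r) /=.
rewrite !(add_block_mx, add_row_mx, add_col_mx, addr0, add0r, Ask).
rewrite !(opp_block_mx, opp_row_mx, opp_col_mx, opprK, oppr0).
by rewrite !(raddfN (@scalar_mx R 1)) opprK.
Qed.

Lemma lorentz_skew B v w : B^T *m gram = - (gram *m B) ->
  lorentz (B *m v) w = - lorentz v (B *m w).
Proof.
by move=> H; rewrite /lorentz trmx_mul -[_ *m _ *m gram]mulmxA H mulmxN !mulNmx mxE !mulmxA.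
Qed.

Lemma gmx_lvec a X z A : gmx a X z A *m lvec = emb (a, X).
Proof.
rewrite /gmx /lvec mul_block_col !mul_block_col !mulmx1 !mulmx0 !addr0 mul_row_col mul0mx.
rewrite mulmx0 addr0 /emb /lvec /evec /= !scale_col_mx !add_col_mx !scaler0 !(addr0, add0r).
by rewrite scalemx1.
Qed.

Lemma galg_lvec B : galg B -> B *m lvec = emb (gmodh B).
Proof.
move=> [a [X [z [A [Ask ->]]]]]; rewrite gmx_lvec; congr (emb (_, _)).
  by rewrite /gmx !block_mxKul mxE.
by rewrite /gmx block_mxKul block_mxKdl.
Qed.

Lemma galg_emb y : exists2 B, galg B & B *m lvec = emb y.
Proof.
exists (gmx y.1 y.2 0 0); last by rewrite gmx_lvec -surjective_pairing.
by exists y.1, y.2, 0, 0; rewrite trmx0 oppr0.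
Qed.

Lemma halg_lvec B : halg B -> B *m lvec = 0.
Proof.
move=> [z [A [_ ->]]]; rewrite gmx_lvec /emb /= scale0r add0r.
exact: lin0 evec_linear.
Qed.

(** A coordinate-free test for membership in h. Its two conditions are exactly what differentiating
    the equations of H yields. *)
Lemma halgP B : B^T *m gram = - (gram *m B) -> B *m lvec = 0 -> halg B.
Proof.
rewrite -[B]submxK -[ulsubmx B]submxK -[ursubmx B]vsubmxK -[dlsubmx B]hsubmxK.
move: (ulsubmx (ulsubmx B)) (ursubmx (ulsubmx B)) (dlsubmx (ulsubmx B)) (drsubmx (ulsubmx B))
  (usubmx (ursubmx B)) (dsubmx (ursubmx B)) (lsubmx (dlsubmx B)) (rsubmx (dlsubmx B)) (drsubmx B).
clear B => b11 b12 b21 b22 b13 b23 b31 b32 b33.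
rewrite /gram /lvec !(tr_block_mx, tr_col_mx, tr_row_mx) !mulmx_block.
rewrite !(mul_block_col, mul_row_block, mul_col_row, mul_row_col, mulmx_block,
  mul_mx_row, mul_col_mx).
rewrite !(mul0mx, mulmx0, mul1mx, mulmx1, addr0, add0r).
rewrite !(add_block_mx, add_row_mx, add_col_mx, addr0, add0r).
rewrite !(opp_block_mx, opp_row_mx, opp_col_mx).
move=> /eq_block_mx[/eq_block_mx[_ e2 _ e4] /eq_col_mx[e5 e6] _ e9] z.
have /eq_col_mx[/eq_col_mx[z1 z2] z3] :
    col_mx (col_mx b11 b21) b31 = col_mx (col_mx 0 0) 0 by rewrite z !col_mx0.
(* This corner is a 1 x 1 block, and skewness makes it equal to its own opposite. *)
have -> : b13 = 0.
  by apply/matrixP => i j; move/matrixP/(_ j i): e9; rewrite !ord1 !mxE; lra.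
have -> : b33 = 0 by rewrite -[b33]opprK -e5 z1 trmx0 oppr0.
have -> : b32 = 0 by rewrite -[b32]opprK -e2 z2 trmx0 oppr0.
have -> : b23 = - b12^T by rewrite e6 opprK.
exists b12, b22; split=> //; rewrite /gmx z1 z2 z3 oppr0 trmx0 oppr0.
by rewrite -[0 in LHS](raddf0 (@scalar_mx R 1)) !(raddf0 (@scalar_mx R 1)).
Qed.

Lemma mx00_inj p q (A A' : 'M[R]_(p, q)) :
  (forall (v : 'cV[R]_p) (w : 'cV[R]_q), (v^T *m A *m w) 0 0 = (v^T *m A' *m w) 0 0) -> A = A'.
Proof.
move=> H; apply/matrixP => i j; have := H (delta_mx i 0) (delta_mx j 0).
by rewrite !trmx_delta -!rowE -!colE !mxE.
Qed.

Lemma isometryP k : (forall v w, lorentz (k *m v) (k *m w) = lorentz v w) ->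
  k^T *m gram *m k = gram.
Proof.
by move=> H; apply: mx00_inj => v w; have := H v w; rewrite /lorentz trmx_mul !mulmxA.
Qed.

Lemma Hgrp_gram k : Hgrp k -> k^T *m gram *m k = gram.
Proof. by case=> [[/isometryP]]. Qed.

Lemma Hgrp_lvec k : Hgrp k -> k *m lvec = lvec. Proof. by case. Qed.

Lemma Hgrp_unit k : Hgrp k -> k \in unitmx.
Proof.
move=> /Hgrp_gram kg; have : gram *m k^T *m gram *m k = 1%:M.
  by rewrite -!mulmxA (mulmxA k^T) kg gramK.
by case/mulmx1_unit.
Qed.

Lemma Hgrp_lorentz k v w : Hgrp k -> lorentz (k *m v) (k *m w) = lorentz v w.
Proof. by case=> [[]]. Qed.

(** Orthogonality to l - n equates the coefficients of l and n in v. With b their common value and X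
    the spatial part, <v,v> = 2 b^2 + |X|^2, which vanishes only for v = 0. *)
Lemma future_cone_sign v : v != 0 -> lorentz v v = 0 -> lorentz v (lvec - nvec) != 0.
Proof.
move=> v0 vv; apply: contra_neq v0 => H; have [X vE] := vec_decomp v.
have vln : lorentz v nvec = lorentz v lvec by move: H; rewrite !lorentzE; lra.
have [X0 X1] := lorentz_evec_ge0 X.
have b0 : lorentz v lvec = 0 /\ lorentz (evec X) (evec X) = 0.
  move: vv; rewrite {1 2}vE vln; set b := lorentz v lvec.
  rewrite !lorentzE lorentz_lvec lorentz_nvec lorentz_evec_lvec lorentz_evec_nvec.
  rewrite (lorentzC lvec (evec X)) (lorentzC nvec (evec X)) (lorentzC nvec lvec).
  rewrite lorentz_evec_lvec lorentz_evec_nvec lorentz_lvec_nvec; split; nra.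
by rewrite vE vln b0.1 (X1 b0.2) !scale0r (lin0 evec_linear) !addr0.
Qed.

Lemma Hgrp1 : Hgrp 1%:M.
Proof.
split; last by rewrite mul1mx.
by split=> [v w|v]; rewrite !mul1mx.
Qed.

Lemma HgrpM k k' : Hgrp k -> Hgrp k' -> Hgrp (k *m k').
Proof.
move=> [[ki kf] kl] [[ki' kf'] kl']; split; last by rewrite -mulmxA kl' kl.
split=> [v w|v vf]; first by rewrite -!mulmxA ki ki'.
by rewrite -mulmxA; apply: kf; apply: kf'.
Qed.

(** [Ggrp] only says that k maps the future cone into itself, so the inverse needs an argument. If
    k^-1 v were in the past half for a future v, then - k^-1 v would be future and k would send it
    to - v. *)
Lemma HgrpV k : Hgrp k -> Hgrp (invmx k).
Proof.
move=> Hk; have ku := Hgrp_unit Hk; have [[ki kf] kl] := Hk.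
have vi v w : lorentz (invmx k *m v) (invmx k *m w) = lorentz v w.
  by rewrite -ki !mulKVmx.
split; last by rewrite -{1}kl mulKmx.
split=> // v [v0 vv vf].
have kv0 : invmx k *m v != 0.
  by apply: contra_neq v0 => e; rewrite -(mulKVmx ku v) e mulmx0.
have kvv : lorentz (invmx k *m v) (invmx k *m v) = 0 by rewrite vi.
split=> //; case: ltgtP (future_cone_sign kv0 kvv) => // H _.
have /kf [_ _] : future_cone (- (invmx k *m v)).
  by split; rewrite ?oppr_eq0 // ?lorentzNl ?lorentzNr ?kvv ?oppr0 // oppr_lt0.
by rewrite mulmxN mulKVmx // lorentzNl; lra.
Qed.

Lemma Hgrp_invE k : Hgrp k -> invmx k = gram *m k^T *m gram.
Proof.
move=> Hk; have := Hgrp_gram Hk => kg.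
rewrite -[RHS](mulmxK (Hgrp_unit Hk)) -!mulmxA (mulmxA k^T) [in RHS](mulmxA (k^T *m gram)) kg.
by rewrite mulmxA gramK mul1mx.
Qed.

Lemma Hgrp_lvecV k : Hgrp k -> invmx k *m lvec = lvec.
Proof. by move/HgrpV/Hgrp_lvec. Qed.

(** The Maurer-Cartan form of H takes values in h: differentiate the two equations c^T gram c = gram
    and c l = l, which hold near x, and translate back to the identity. *)
Lemma halg_diff (V : normedModType R) (c : V -> 'M[R]_(1 + m + 1)) (x v : V) :
  differentiable c x -> (\forall y \near x, Hgrp (c y)) ->
  halg (invmx (c x) *m 'd c x v).
Proof.
move=> dc Hc; have Hx := nbhs_singleton Hc; set B := 'd c x v.
have [dcg dcgE] := diff_mulmxl gram v dc.
have [dct dctE] := diff_trmx v dc.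
have gB : B^T *m gram *m c x + (c x)^T *m gram *m B = 0.
  rewrite -mulmxA -(mulmxA (c x)^T); apply: etrans (esym (diff_mulmx dct dcg dctE dcgE)) _.
  apply: (@near_cst_diffE _ _ _ _ gram).
  by apply: filterS Hc => y /Hgrp_gram; rewrite mulmxA.
have Bl : B *m lvec = 0.
  have [_ <-] := diff_mulmxr lvec v dc; apply: (@near_cst_diffE _ _ _ _ lvec).
  by apply: filterS Hc => y /Hgrp_lvec.
apply: halgP; last by rewrite -mulmxA Bl mulmx0.
rewrite (Hgrp_invE Hx) !trmx_mul trmxK !gram_tr !mulmxA gramK mul1mx.
rewrite -[_ *m gram *m gram]mulmxA gramK mulmx1.
by apply/eqP; rewrite -addr_eq0 gB.
Qed.

End LorentzAlgebra.

(** * Global smooth curves with a prescribed velocity *)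

Section Curves.
Context {R : realType}.

(* A germ of a map is turned into a globally defined curve by precomposing with
   a smooth bounded function of derivative 1 at 0, here [e^2 t / (e^2 + t^2)]. *)
Lemma smooth_clamp (e : R) : 0 < e -> exists f : R^o -> R^o,
  [/\ forall t, smooth_at f t, forall t, `|f t| < e, f 0 = 0 & 'd f (0 : R^o) (1 : R^o) = 1].
Proof.
move=> e0; pose den (t : R^o) : R^o := e ^+ 2 + t * t.
have den0 t : 0 < den t by rewrite /den; have := sqr_ge0 t; rewrite expr2; nra.
have dS t : smooth_at den t.
  by apply: smooth_at_add; [exact: smooth_at_cst | apply: smooth_at_mul; exact: smooth_at_id].
pose g (t : R^o) : R^o := e ^+ 2 * (den t)^-1.
have gS t : smooth_at g t.
  apply: smooth_at_mul; first exact: smooth_at_cst.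
  by apply: smooth_at_inv; [exact: dS | rewrite gt_eqF].
have e2 : e ^+ 2 != 0 by rewrite expf_neq0 // gt_eqF.
exists (fun t => t *: g t); split.
- by move=> t; apply: smooth_at_scale; [exact: smooth_at_id | exact: gS].
- move=> t; rewrite /g /GRing.scale /= mulrA normrM normfV (gtr0_norm (den0 t)).
  rewrite ltr_pdivrMr ?den0 // normrM (gtr0_norm (exprn_gt0 _ e0)) /den.
  have : `|t| ^+ 2 = t * t by rewrite real_normK ?num_real // expr2.
  have := normr_ge0 t; move: (`|t|) => r r0 <-.
  (* The bound reads r e^2 < e (e^2 + r^2), and this product is the difference of the two sides. *)
  by have : 0 < e * (e ^+ 2 - e * r + r ^+ 2); [apply: mulr_gt0 => //; nra | nra].
- by rewrite scale0r.
have d1 : differentiable (@id R^o) (0 : R^o) := smooth_at_diff (smooth_at_id _).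
have [_ H] := @diff_bilin_comp _ _ _ _ _ (@GRing.scale R R^o : R^o -> R^o -> R^o) id g 0
   (@scale_continuous _ _) d1 (smooth_at_diff (gS 0)).
apply: etrans (H 1) _.
rewrite (@diff_linE _ _ _ idfun) /=; last by move=> ?; exact: cvg_id.
by rewrite scale0r addr0 scale1r /g /den mulr0 addr0 divff.
Qed.

(** [fundamental] quantifies over curves that are smooth and stay in H at all times, whereas a map
    into H is usually known only near a point. The clamp keeps x + g(t) v inside the ball where f is
    smooth with values in Q and preserves the velocity at 0. *)
Lemma smooth_curve_extension (V W : normedModType R) (f : V -> W) (Q : W -> Prop) (x v : V) :
  fin_dim V -> smooth_at f x -> (\forall y \near x, Q (f y)) ->
  exists c : R^o -> W, [/\ forall t, smooth_at c t, forall t, Q (c t), c 0 = f x &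
    'd c (0 : R^o) (1 : R^o) = 'd f x v].
Proof.
move=> fV fS fQ.
have near0 : \forall t \near (0 : R^o), smooth_at f (x + t *: v) /\ Q (f (x + t *: v)).
  have lc : {for (0 : R^o), continuous (fun t : R^o => x + t *: v)}.
    by apply: (@cvgD _ _ _ (nbhs (0 : R^o))); [exact: cvg_cst | exact: scalel_continuous].
  have nx : nbhs (x + (0 : R^o) *: v) [set y | smooth_at f y /\ Q (f y)].
    by rewrite scale0r addr0; apply: filterI => //; exact: smooth_at_near.
  exact: (lc _ nx).
have /nbhs_ballP[e /= e0 He] : nbhs (0 : R^o)
    [set t | smooth_at f (x + t *: v) /\ Q (f (x + t *: v))].
  exact: near0.
have [g [gS gb g0 gd]] := smooth_clamp e0.
have Hg t : smooth_at f (x + g t *: v) /\ Q (f (x + g t *: v)).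
  by apply: He; rewrite /ball /= sub0r normrN; exact: gb.
have aS t : smooth_at (fun t : R^o => x + g t *: v) t.
  apply: smooth_at_add; first exact: smooth_at_cst.
  by apply: smooth_at_scale; [exact: gS | exact: smooth_at_cst].
exists (fun t => f (x + g t *: v)); split.
- by move=> t; apply: (smooth_at_comp (f := fun t : R^o => x + g t *: v) fV (aS t) (Hg t).1).
- by move=> t; exact: (Hg t).2.
- by rewrite g0 scale0r addr0.
have e1 : x + g 0 *: v = x by rewrite g0 scale0r addr0.
have ne : \forall t \near (0 : R^o), f (x + g t *: v) = f (x + g t *: v) by apply: filterE => t.
apply: etrans (@diff_near_comp _ _ _ _ (fun t : R^o => x + g t *: v) f _ 0 x 1 ne e1
  (smooth_at_diff (aS 0)) (smooth_at_diff fS)) _.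
congr ('d f x _).
have dg := smooth_at_diff (gS 0).
have dv := @differentiableZl R _ _ g v 0 dg.
have e2 : 'd (fun t : R^o => g t *: v) (0 : R^o) 1 = v.
  by rewrite (diffZl v dg) gd scale1r.
have dx := @differentiable_cst R R^o V x 0.
apply: etrans (congr1 (@^~ (1 : R^o)) (diffD dx dv)) _.
by rewrite /= e2 diff_cst add0r.
Qed.

End Curves.

(** * The Leibniz rule for the principal action *)

Section Bundle.
Context {R : realType} {m d : nat} {N : manifold R m.+1} {P : manifold R d}.
Variable C : lightlike_cartan N P.
Notation TN := 'rV[R]_m.+1.
Notation L := 'cV[R]_(1 + m + 1).
Notation Mat := 'M[R]_(1 + m + 1).
Notation lvec := (@lvec R m).
Notation p := (proj C).
Notation act := (act C).
Notation om := (omega C).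
Notation Hgrp := (@Hgrp R m).
Implicit Types (u : P) (k : Mat).

Let PB := cartan_principal C.

(** The action extends locally to a smooth map of pairs (coordinates, matrix), and T is the
    differential of that extension. One T serves all pairs (s, c), so it can be evaluated separately
    on pairs with c constant and on pairs with s constant, and the results added. *)
Lemma act_diff u k0 : Hgrp k0 ->
  exists T : {linear ('rV[R]_d * Mat)%type -> 'rV[R]_d},
  forall (V : normedModType R) (s : V -> P) (c : V -> Mat) (z v : V),
    s z = u -> c z = k0 -> (\forall z' \near z, cdom u (s z')) ->
    differentiable (cmap u \o s) z -> differentiable c z ->
    (\forall z' \near z, Hgrp (c z')) ->
    differentiable (fun z' => cmap (act u k0) (act (s z') (c z'))) z /\
    'd (fun z' => cmap (act u k0) (act (s z') (c z'))) z v
    = T ('d (cmap u \o s) z v, 'd c z v).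
Proof.
move=> Hk; have [F [FS Fn]] := act_smooth PB u Hk.
exists ('d F (cmap u u, k0)) => V s c z v sz cz sn ds dc Hc.
have dp := differentiable_pair ds dc.
have ez : (fun y => ((cmap u \o s) y, c y)) z = (cmap u u, k0) by rewrite /= sz cz.
have pc := differentiable_continuous dp; rewrite /prop_for /continuous_at ez in pc.
have ne : \forall z' \near z,
    F ((cmap u \o s) z', c z') = cmap (act u k0) (act (s z') (c z')).
  have Fn' : \forall z' \near z, Hgrp (c z') ->
      cdom (act u k0) (act (cinv u (cmap u (s z'))) (c z')) /\
      cmap (act u k0) (act (cinv u (cmap u (s z'))) (c z')) = F (cmap u (s z'), c z').
    exact: pc _ Fn.
  by apply: filterS3 sn Hc Fn' => z' sz' Hz' /(_ Hz') [_ <-]; rewrite /= cmapK.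
have dF := smooth_at_diff FS.
have dF' : differentiable F ((fun y => ((cmap u \o s) y, c y)) z) by rewrite ez.
split; first by have [] := near_eq_diff ne (differentiable_comp dp dF').
apply: etrans (@diff_near_comp _ _ _ _ (fun y => ((cmap u \o s) y, c y)) F _ z _ v ne ez dp dF) _.
by congr ('d F _ _); exact: (congr1 (@^~ v) (diff_pair ds dc)).
Qed.

Lemma right_translation_smooth u k : Hgrp k -> smooth_map_at (fun u' => act u' k) u.
Proof.
move=> Hk; have [F [FS Fn]] := act_smooth PB u Hk.
have uu := cdom_self u.
have pS : smooth_at (fun z : 'rV[R]_d => (z, k)) (cmap u u).
  by apply: smooth_at_pair; [exact: smooth_at_id | exact: smooth_at_cst].
have FkS : smooth_at (F \o (fun z : 'rV[R]_d => (z, k))) (cmap u u).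
  by apply: smooth_at_comp => //; apply: fin_dim_pair; exact: fin_dim_mx.
have ne : \forall z \near cmap u u, cdom (act u k) (act (cinv u z) k) /\
    cmap (act u k) (act (cinv u z) k) = F (z, k).
  have Fn' : \forall z \near cmap u u, Hgrp k -> cdom (act u k) (act (cinv u z) k) /\
      cmap (act u k) (act (cinv u z) k) = F (z, k) by exact: smooth_at_continuous pS _ Fn.
  by apply: filterS Fn' => z; apply.
have sS : smooth_at (cmap (act u k) \o (fun u' => act u' k) \o cinv u) (cmap u u).
  by apply: smooth_at_near_eq FkS; apply: filterS ne => z [_ /esym].
split=> //.
(* [smooth_map_at] also asks for continuity between the manifolds. Near u the translation is its
   smooth chart expression followed by the inverse chart. *)
have ne' : \forall u' \near u, cinv (act u k)
    ((cmap (act u k) \o (fun u' => act u' k) \o cinv u) (cmap u u')) = act u' k.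
  have := near_cmap uu ne; apply: filterS2 (near_cdom uu) => u' uu' [].
  by rewrite /= (cmapK uu') => H _; rewrite cmapK.
have cc : {for u, continuous (fun u' => cinv (act u k)
    ((cmap (act u k) \o (fun u' => act u' k) \o cinv u) (cmap u u')))}.
  apply: (@continuous_comp _ _ _ (cmap u) (cinv (act u k) \o
    (cmap (act u k) \o (fun u' => act u' k) \o cinv u))); first exact: cmap_continuous.
  apply: (@continuous_comp _ _ _ (cmap (act u k) \o (fun u' => act u' k) \o cinv u)
    (cinv (act u k))); first exact: smooth_at_continuous sS.
  by rewrite /= cmapK //; apply: cinv_continuous; exact: cdom_self.
rewrite /prop_for /continuous_at -(nbhs_singleton ne').
by apply: cvg_trans cc; apply: near_eq_cvg.
Qed.

Lemma tangent_map_id (M : manifold R m.+1) (f : M -> M) (x : M) w :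
  (\forall y \near x, f y = y) -> tangent_map f x w = w.
Proof.
move=> fn; have xx := cdom_self x; have fx := nbhs_singleton fn.
rewrite /tangent_map fx; apply: etrans (transition_id w xx).
apply: near_eq_diffE; last exact: smooth_at_diff (transition_smooth xx xx).
by apply: filterS (near_cinv xx fn) => z /= ->.
Qed.

Lemma tangent_map_near_eq (q q' : nat) (M : manifold R q) (M' : manifold R q')
    (f g : M -> M') (x : M) w :
  (\forall y \near x, f y = g y) -> smooth_map_at f x ->
  tangent_map g x w = tangent_map f x w.
Proof.
move=> fg [_ fS]; have xx := cdom_self x; have fx := nbhs_singleton fg.
rewrite /tangent_map -fx; apply: near_eq_diffE; last exact: smooth_at_diff fS.
by apply: filterS (near_cinv xx fg) => z /= ->.
Qed.

(** By [act_diff] the velocity of an orbit depends on the curve only through its derivative at 0, so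
    the description defining [fundamental] has exactly one solution. *)
Lemma fundamentalE u (c : R^o -> Mat) :
  (forall t, smooth_at c t) -> (forall t, Hgrp (c t)) -> c 0 = 1%:M ->
  fundamental act ('D_1 c 0) u = velocity u (fun t => act u (c t)).
Proof.
move=> cS Hc c0; have [T HT] := act_diff u (@Hgrp1 R m).
have vE (c' : R^o -> Mat) : (forall t, smooth_at c' t) -> (forall t, Hgrp (c' t)) ->
    c' 0 = 1%:M -> velocity u (fun t => act u (c' t)) = T (0, 'D_1 c' 0).
  move=> cS' Hc' c0'; rewrite /velocity.
  have dc' := smooth_at_diff (cS' 0).
  have dcst := @differentiable_cst R R^o 'rV[R]_d (cmap u u) 0.
  have cn : \forall z' \near (0 : R^o), cdom u ((fun=> u) z').
    by apply: filterE => t; exact: cdom_self.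
  have Hn : \forall z' \near (0 : R^o), Hgrp (c' z') by apply: filterE.
  have [d1 d2] := HT R^o (fun=> u) c' 0 1 erefl c0' cn dcst dc' Hn.
  rewrite (act1 PB) in d1 d2.
  rewrite (deriveE _ d1) (deriveE _ dc'); apply: etrans d2 _.
  by congr (T (_, _)); exact: diff_cstE.
rewrite /fundamental; apply: get_unique => [c' cS' Hc' c0' e|z Hz].
  by rewrite !vE // e.
exact: Hz.
Qed.

(* The second term depends only on the derivative of [c], so [c] may be replaced
   by a global curve in H, where [omega_fundamental] applies. *)
Lemma omega_leibniz (V : normedModType R) (s : V -> P) (c : V -> Mat) (z v : V) :
  fin_dim V -> (\forall z' \near z, cdom (s z) (s z')) ->
  differentiable (cmap (s z) \o s) z -> smooth_at c z ->
  (\forall z' \near z, Hgrp (c z')) ->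
  om (act (s z) (c z)) ('d (fun z' => cmap (act (s z) (c z)) (act (s z') (c z'))) z v)
  = invmx (c z) *m om (s z) ('d (cmap (s z) \o s) z v) *m c z + invmx (c z) *m 'd c z v.
Proof.
move=> fV sn ds cS Hc; have Hz := nbhs_singleton Hc.
set u := s z in sn ds *; set k0 := c z in Hz *.
have uu := cdom_self u.
have dc := smooth_at_diff cS.
have [T HT] := act_diff u Hz.
have [_ HTv] := HT V s c z v erefl erefl sn ds dc Hc.
apply: etrans (congr1 (om (act u k0)) HTv) _ => {HTv}.
set a := 'd (cmap u \o s) z v; set b := 'd c z v.
(* Fixing the group element and moving the point leaves a right translation, where equivariance of
   [omega] applies. *)
have T1 : T (a, 0) = tangent_map (fun u' => act u' k0) u a.
  have cn : \forall z' \near cmap u u, cdom u (cinv u z').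
    by apply: filterS (near_chart uu) => z' [].
  have dcst := @differentiable_cst R 'rV[R]_d Mat k0 (cmap u u).
  have did : differentiable (cmap u \o cinv u) (cmap u u).
    exact: smooth_at_diff (transition_smooth uu uu).
  have Hn : \forall z' \near cmap u u, Hgrp ((fun=> k0) z') by apply: filterE.
  have [_ d2] := HT _ (cinv u) (fun=> k0) (cmap u u) a (cmapK uu) erefl cn did dcst Hn.
  apply: etrans (esym d2) => /=; congr (T (_, _)); first by rewrite transition_id.
  by apply/esym; exact: diff_cstE.
have [g [gS gH g0 gd]] := smooth_curve_extension v fV cS Hc.
rewrite -/b -/k0 in g0 gd.
have dg := smooth_at_diff (gS 0).
have ku := Hgrp_unit Hz.
(* Translated to start at the identity: act u (g t) is the orbit of act u k0 under h, so T (0, b) is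
   a fundamental vector there. *)
pose h (t : R^o) := invmx k0 *m g t.
have hS t : smooth_at h t by apply: smooth_at_mulmx; [exact: smooth_at_cst | exact: gS].
have hH t : Hgrp (h t) by apply: HgrpM; [exact: HgrpV | exact: gH].
have h0 : h 0 = 1%:M by rewrite /h g0 mulVmx.
have hd : 'D_1 h 0 = invmx k0 *m b.
  rewrite (deriveE _ (smooth_at_diff (hS 0))) -gd.
  by have [_] := diff_mulmxl (invmx k0) (1 : R^o) dg.
have T2 : T (0, b) = fundamental act (invmx k0 *m b) (act u k0).
  rewrite -hd fundamentalE // /velocity.
  have dcst := @differentiable_cst R R^o 'rV[R]_d (cmap u u) 0.
  have cn : \forall z' \near (0 : R^o), cdom u ((fun=> u) z') by apply: filterE.
  have Hn : \forall z' \near (0 : R^o), Hgrp (g z') by apply: filterE.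
  have [d1 d2] := HT R^o (fun=> u) g 0 1 erefl g0 cn dcst dg Hn.
  have -> : cmap (act u k0) \o (fun t => act (act u k0) (h t)) =
            (fun t => cmap (act u k0) (act u (g t))).
    by rewrite funeqE => t; rewrite /= -(actM PB u Hz (hH t)) /h mulKVmx.
  rewrite (deriveE _ d1); apply: etrans _ (esym d2); rewrite gd; congr (T (_, _)).
  by apply/esym; exact: diff_cstE.
have hB : halg (invmx k0 *m b) by apply: halg_diff.
have ol : linear (om (act u k0)) by have [] := omega_smooth C.
have -> : (a, b) = (a, 0) + (0, b) :> 'rV[R]_d * Mat by rewrite pairD addr0 add0r.
rewrite linearD T1 T2 -[X in om _ (X + _)]scale1r ol scale1r omega_equivariant //.
by rewrite omega_fundamental.
Qed.

End Bundle.

(** * The solder form *)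

Section Frames.
Context {R : realType} {m d : nat} {N : manifold R m.+1} {P : manifold R d}.
Variable C : lightlike_cartan N P.
Notation TN := 'rV[R]_m.+1.
Notation L := 'cV[R]_(1 + m + 1).
Notation Mat := 'M[R]_(1 + m + 1).
Notation lvec := (@lvec R m).
Notation p := (proj C).
Notation act := (act C).
Notation om := (omega C).
Notation Hgrp := (@Hgrp R m).
Implicit Types (u : P) (x : N) (k : Mat) (s : N -> P) (w : TN).

Let PB := cartan_principal C.

Lemma omega_linear u : linear (om u). Proof. by have [] := omega_smooth C. Qed.

Lemma tangent_map_linear (q q' : nat) (M : manifold R q) (M' : manifold R q')
  (f : M -> M') (x : M) : linear (tangent_map f x).
Proof. by move=> a v w; rewrite /tangent_map linearP. Qed.

Lemma act_inj u k k' : Hgrp k -> Hgrp k' -> act u k = act u k' -> k = k'.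
Proof.
move=> Hk Hk' e; have [U [s [g [[_ Ux] _ gU gK]]]] := locally_trivial PB (p u).
have [_ Hg gu] := gU u Ux.
move: e; rewrite -gu -(actM PB _ Hg Hk) -(actM PB _ Hg Hk') => /(congr1 g).
rewrite !gK //; try exact: HgrpM.
by move/(congr1 (mulmx (invmx (g u)))); rewrite !mulKmx ?Hgrp_unit.
Qed.

Lemma act_transitive u u' : p u = p u' -> exists2 k, Hgrp k & u' = act u k.
Proof.
move=> e; have [U [s [g [[_ Ux] _ gU gK]]]] := locally_trivial PB (p u).
have [_ Hg gu] := gU u Ux.
have [|_ Hg' gu'] := gU u'; first by rewrite -e.
have Hk : Hgrp (invmx (g u) *m g u') by apply: HgrpM => //; exact: HgrpV.
exists (invmx (g u) *m g u') => //.
by rewrite -[u in act u _]gu -(actM PB _ Hg Hk) mulKVmx ?Hgrp_unit // e gu'.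
Qed.

Lemma exists_section x : exists s : N -> P,
  \forall y \near x, smooth_map_at s y /\ p (s y) = y.
Proof.
have [U [s [g [[oU Ux] sU _ _]]]] := locally_trivial PB x; exists s.
by apply: filterS (open_nbhs_nbhs (conj oU Ux)) => y /sU.
Qed.

Lemma tangent_proj_section s x w : smooth_map_at s x ->
  (\forall y \near x, p (s y) = y) ->
  tangent_map p (s x) (tangent_map s x w) = w.
Proof.
move=> sS ps; have [_ H] := smooth_map_comp sS (proj_smooth PB (s x)).
by rewrite -H; exact: tangent_map_id.
Qed.

Lemma tangent_proj_act u k z : Hgrp k ->
  tangent_map p (act u k) (tangent_map (fun u' => act u' k) u z) = tangent_map p u z.
Proof.
move=> Hk; have rS := right_translation_smooth C u Hk.
have [cS H] := smooth_map_comp rS (proj_smooth PB (act u k)).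
rewrite -H; apply/esym; apply: tangent_map_near_eq cS.
by apply: filterE => u' /=; rewrite (proj_act PB).
Qed.

Lemma tangent_proj_surj u w : exists z, tangent_map p u z = w.
Proof.
have [s sS] := exists_section (p u); have [s1 s2] := nbhs_singleton sS.
have [k Hk ->] := act_transitive s2.
exists (tangent_map (fun u' => act u' k) (s (p u)) (tangent_map s (p u) w)).
rewrite tangent_proj_act //; apply: tangent_proj_section => //.
by apply: filterS sS => y [].
Qed.

(** In a trivialization u = s(p u) g(u). Applying the Leibniz rule to this identity expresses
    omega(z) by a term in T(s o p) z, which vanishes for vertical z, and by g^-1 dg(z), which is in
    h. *)
Lemma omega_vertical u z : tangent_map p u z = 0 -> halg (om u z).
Proof.
move=> pz; have [U [s [g [[oU Ux] sU gU gK]]]] := locally_trivial PB (p u).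
have uu := cdom_self u; have pS := proj_smooth PB u.
have [gS Hg gu] := gU u Ux; have [sS _] := sU _ Ux.
have [spS spT] := smooth_map_comp pS sS.
have nU : \forall u' \near u, U (p u').
  by apply: pS.1; exact: open_nbhs_nbhs.
pose S := (s \o p) \o cinv u; pose G := g \o cinv u; pose z0 := cmap u u.
have S0 : S z0 = s (p u) by rewrite /S /z0 /= cmapK.
have G0 : G z0 = g u by rewrite /G /z0 /= cmapK.
have sn : \forall z' \near z0, cdom (S z0) (S z').
  by rewrite S0; exact: near_cinv uu (near_map_cdom spS.1).
have ds : differentiable (cmap (S z0) \o S) z0.
  by rewrite S0; exact: smooth_at_diff spS.2.
have HG : \forall z' \near z0, Hgrp (G z').
  by apply: filterS (near_cinv uu nU) => z' /gU [].
have H := omega_leibniz C z (@fin_dim_mx R 1 d) sn ds gS HG.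
have e1 : 'd (fun z' => cmap (act (S z0) (G z0)) (act (S z') (G z'))) z0 z = z.
  apply: etrans (transition_id z uu); rewrite S0 G0 gu.
  apply: near_eq_diffE; last exact: smooth_at_diff (transition_smooth uu uu).
  by apply: filterS (near_cinv uu nU) => z' /gU [_ _ e] /=; rewrite /S /G /= e.
have e2 : om (S z0) ('d (cmap (S z0) \o S) z0 z) = 0.
  have -> : 'd (cmap (S z0) \o S) z0 z = tangent_map (s \o p) u z by rewrite S0.
  by rewrite spT pz (lin0 (tangent_map_linear s (p u))) (lin0 (omega_linear _)).
have e3 : om u z = invmx (G z0) *m 'd G z0 z.
  have : om (act (S z0) (G z0)) z = invmx (G z0) *m 'd G z0 z.
    apply: etrans (congr1 (om _) (esym e1)) _; apply: etrans H _.
    by rewrite e2 mulmx0 mul0mx add0r.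
  by rewrite {1}S0 {1}G0 gu.
by rewrite e3; apply: halg_diff => //; exact: smooth_at_diff gS.
Qed.

(* [phi u], with g/h identified with [lvec^perp] by [B |-> B lvec] *)
Definition psi u w : L := emb (phi C u w).

Lemma psi_lift u z : psi u (tangent_map p u z) = om u z *m lvec.
Proof.
rewrite galg_lvec; last exact: omega_galg.
congr emb; apply: get_unique => [z' e|y Hy]; last exact: Hy.
apply: emb_inj; rewrite -!galg_lvec; try exact: omega_galg.
apply/eqP; rewrite -subr_eq0 -mulmxBl.
have -> : om u z - om u z' = om u (z - z').
  by rewrite addrC -scaleN1r -omega_linear scaleN1r addrC.
rewrite halg_lvec //; apply: omega_vertical.
by rewrite addrC -scaleN1r tangent_map_linear scaleN1r e addNr.
Qed.

Lemma psi_section s x w : smooth_map_at s x -> (\forall y \near x, p (s y) = y) ->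
  psi (s x) w = om (s x) (tangent_map s x w) *m lvec.
Proof. by move=> sS ps; rewrite -psi_lift tangent_proj_section. Qed.

Lemma psi_linear u : linear (psi u).
Proof.
move=> a v w; have [z <-] := tangent_proj_surj u v; have [z' <-] := tangent_proj_surj u w.
by rewrite -tangent_map_linear !psi_lift omega_linear mulmxDl scalemxAl.
Qed.

Lemma psi_perp u w : lorentz (psi u w) lvec = 0. Proof. exact: emb_lvec. Qed.

Lemma psi_act u k w : Hgrp k -> psi (act u k) w = invmx k *m psi u w.
Proof.
move=> Hk; have [z <-] := tangent_proj_surj u w.
rewrite -{1}(tangent_proj_act u z Hk) !psi_lift omega_equivariant //.
by rewrite -!mulmxA (Hgrp_lvec Hk).
Qed.

Lemma psi_surj u (v : L) : lorentz v lvec = 0 -> exists w, psi u w = v.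
Proof.
move=> /embP[y ->]; have [B /(omega_surj C u)[z zB] <-] := galg_emb y.
by exists (tangent_map p u z); rewrite psi_lift zB.
Qed.

(* the dropped last coordinate vanishes on [lvec^perp] *)
Definition perp_coord (v : L) : TN := (usubmx v)^T.

Lemma perp_coord_linear : linear perp_coord.
Proof. by move=> a v w; rewrite /perp_coord !linearP. Qed.

Lemma perp_coord_emb (t : TN) : exists y, perp_coord (emb y) = t.
Proof.
have [a [X tE]] : exists a X, t^T = col_mx a%:M X :> 'cV[R]_(1 + m).
  exists (usubmx (t^T : 'cV[R]_(1 + m)) 0 0), (dsubmx (t^T : 'cV[R]_(1 + m))).
  by rewrite -mx11_scalar vsubmxK.
exists (a, X); rewrite /perp_coord /emb /lvec /evec /=.
rewrite !scale_col_mx !add_col_mx col_mxKu !scaler0 addr0 add0r scalemx1.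
by rewrite -tE trmxK.
Qed.

(** A dimension count: psi u is onto the hyperplane orthogonal to l, and [perp_coord] turns it into
    an endomorphism of R^(m+1), whose matrix is then of full rank and invertible. *)
Lemma psi_coord_inj u : injective (fun w => perp_coord (psi u w)).
Proof.
have lf : linear (fun w => perp_coord (psi u w)).
  by move=> a v w; rewrite psi_linear perp_coord_linear.
pose f : {linear TN -> TN} := HB.pack (fun w => perp_coord (psi u w))
  (GRing.isLinear.Build _ _ _ _ _ lf).
have fE v : v *m lin1_mx f = perp_coord (psi u v) by rewrite mul_rV_lin1.
have Mu : lin1_mx f \in unitmx.
  rewrite -row_full_unit -sub1mx; apply/row_subP => i.
  have [y yE] := perp_coord_emb (row i 1%:M).
  have [w wE] := psi_surj u (emb_lvec y).
  by rewrite -yE -wE -fE; exact: submxMl.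
by move=> v w /= e; rewrite -(mulmxK Mu v) fE e -fE mulmxK.
Qed.

Lemma psi_inj u : injective (psi u).
Proof. by move=> v w e; apply: (@psi_coord_inj u); rewrite /= e. Qed.

Lemma hmetricE u v w : hmetric C (p u) v w = lorentz (psi u v) (psi u w).
Proof.
apply: get_unique => [u' e|r Hr]; last by rewrite lorentz_emb; exact: Hr.
have [k Hk ->] := act_transitive (esym e).
by rewrite -lorentz_emb -!/(psi _ _) !psi_act // Hgrp_lorentz //; exact: HgrpV.
Qed.

Lemma psi_Zfield u : psi u (Zfield C (p u)) = lvec.
Proof.
have e0 : emb (1, 0) = lvec.
  by rewrite /emb /= scale1r (lin0 evec_linear) addr0.
have [w wE] := psi_surj u (@lorentz_lvec R m).
have -> : Zfield C (p u) = w; last by [].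
apply: get_unique => [u' e|v Hv].
  have [k Hk ->] := act_transitive (esym e).
  by apply: emb_inj; rewrite -/(psi _ _) psi_act // wE e0 Hgrp_lvecV.
by apply: (@psi_inj u); rewrite wE -e0 /psi Hv.
Qed.

(** The gauge transformation of the local connection matrix. In a common trivialization the
    transition function is g(s)^-1 g(s'), and the formula is the Leibniz rule for s' = s k. *)
Lemma section_change s s' x : smooth_map_at s x -> smooth_map_at s' x ->
  (\forall y \near x, p (s y) = y) -> (\forall y \near x, p (s' y) = y) ->
  exists kf : N -> Mat, [/\ smooth_fun_at kf x,
    \forall y \near x, Hgrp (kf y) /\ s' y = act (s y) (kf y) &
    forall w, om (s' x) (tangent_map s' x w)
      = invmx (kf x) *m om (s x) (tangent_map s x w) *m kf x
        + invmx (kf x) *m dfun kf x w].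
Proof.
move=> sS sS' ps ps'; have xx := cdom_self x.
have [U [s0 [g [[oU Ux] sU gU gK]]]] := locally_trivial PB x.
have nU : \forall y \near x, U y by exact: open_nbhs_nbhs.
have psx := nbhs_singleton ps; have psx' := nbhs_singleton ps'.
have gs : smooth_fun_at g (s x) by have [] := gU (s x); rewrite ?psx.
have gs' : smooth_fun_at g (s' x) by have [] := gU (s' x); rewrite ?psx'.
have [gS _] := smooth_fun_comp sS gs; have [gS' _] := smooth_fun_comp sS' gs'.
have ne : \forall y \near x, [/\ Hgrp (g (s y)), Hgrp (g (s' y)),
    act (s0 y) (g (s y)) = s y & act (s0 y) (g (s' y)) = s' y].
  apply: filterS3 nU ps ps' => y Uy e e'.
  by have [] := gU (s y); rewrite ?e //; have [] := gU (s' y); rewrite ?e'.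
pose kf y := invmx (g (s y)) *m g (s' y).
have kS : smooth_fun_at kf x.
  apply: smooth_fun_mulmx gS'; apply: smooth_fun_invmx gS _.
  by apply: Hgrp_unit; have [] := nbhs_singleton ne.
have nk : \forall y \near x, Hgrp (kf y) /\ s' y = act (s y) (kf y).
  apply: filterS ne => y [H1 H2 e1 e2].
  have Hk : Hgrp (kf y) by apply: HgrpM => //; exact: HgrpV.
  by split=> //; rewrite -e1 -(actM PB _ H1 Hk) /kf mulKVmx ?Hgrp_unit.
exists kf; split=> // w; have [Hk e] := nbhs_singleton nk.
have sn : \forall z' \near cmap x x, cdom ((s \o cinv x) (cmap x x)) ((s \o cinv x) z').
  by rewrite /= cmapK //; exact: near_cinv xx (near_map_cdom sS.1).
have ds : differentiable (cmap ((s \o cinv x) (cmap x x)) \o (s \o cinv x)) (cmap x x).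
  by rewrite /= cmapK //; exact: smooth_at_diff sS.2.
have HG : \forall z' \near cmap x x, Hgrp ((kf \o cinv x) z').
  by apply: filterS (near_cinv xx nk) => z' [].
have := omega_leibniz C w (@fin_dim_mx R 1 m.+1) sn ds kS HG.
have -> : (s \o cinv x) (cmap x x) = s x by rewrite /= cmapK.
have -> : (kf \o cinv x) (cmap x x) = kf x by rewrite /= cmapK.
have tE : 'd (fun z' => cmap (act (s x) (kf x)) (act ((s \o cinv x) z') ((kf \o cinv x) z')))
    (cmap x x) w = tangent_map s' x w.
  rewrite -e; apply: near_eq_diffE (smooth_at_diff sS'.2).
  by apply: filterS (near_cinv xx nk) => z [_ ez] /=; rewrite ez.
move=> H; have H' := etrans (congr1 (om (act (s x) (kf x))) (esym tE)) H.
by rewrite [X in om X _]e; exact: H'.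
Qed.

End Frames.

(** * Product rules along tangent vectors and for the Lorentz product *)

Section Derivations.
Context {R : realType} {n : nat} {M : manifold R n}.
Implicit Types (x : M) (w : 'rV[R]_n).

Lemma dfun_bilin (E E' F : normedModType R) (b : {bilinear E -> E' -> F})
    (f : M -> E) (g : M -> E') x w :
  continuous (fun q : E * E' => b q.1 q.2) -> smooth_fun_at f x -> smooth_fun_at g x ->
  dfun (fun y => b (f y) (g y)) x w = b (dfun f x w) (g x) + b (f x) (dfun g x w).
Proof.
move=> bc fS gS.
have [_ H] := diff_bilin_comp bc (smooth_at_diff fS) (smooth_at_diff gS).
by apply: etrans (H w) _; rewrite /= cmapK //; exact: cdom_self.
Qed.

Lemma dfun_mulmx (q r t : nat) (A : M -> 'M[R]_(q, r)) (B : M -> 'M[R]_(r, t)) x w :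
  smooth_fun_at A x -> smooth_fun_at B x ->
  dfun (fun y => A y *m B y) x w = dfun A x w *m B x + A x *m dfun B x w.
Proof. by apply: (@dfun_bilin _ _ _ (@mulmx R q r t)); exact: mulmx_continuous. Qed.

Lemma dfun_scale (E : normedModType R) (a : M -> R^o) (f : M -> E) x w :
  smooth_fun_at a x -> smooth_fun_at f x ->
  dfun (fun y => a y *: f y) x w = dfun a x w *: f x + a x *: dfun f x w.
Proof.
by apply: (@dfun_bilin _ _ _ (@GRing.scale R E : R^o -> E -> E)); exact: scale_continuous.
Qed.

Lemma dfun_add (E : normedModType R) (f g : M -> E) x w :
  smooth_fun_at f x -> smooth_fun_at g x ->
  dfun (fun y => f y + g y) x w = dfun f x w + dfun g x w.
Proof.
move=> fS gS.
exact: (congr1 (@^~ w) (diffD (smooth_at_diff fS) (smooth_at_diff gS))).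
Qed.

Lemma dfun_cst (E : normedModType R) (e : E) x w : dfun (fun=> e) x w = 0.
Proof. exact: diff_cstE. Qed.

Lemma dfun_near_cst (E : normedModType R) (f : M -> E) (e : E) x w :
  (\forall y \near x, f y = e) -> dfun f x w = 0.
Proof.
by move=> fe; apply: near_cst_diffE; exact: near_cinv (cdom_self x) fe.
Qed.

Lemma dfun_linear (E : normedModType R) (f : M -> E) x : linear (dfun f x).
Proof. by move=> a v w; rewrite /dfun linearP. Qed.

Lemma dfun_sub (E : normedModType R) (f g : M -> E) x w :
  smooth_fun_at f x -> smooth_fun_at g x ->
  dfun (fun y => f y - g y) x w = dfun f x w - dfun g x w.
Proof.
move=> fS gS; rewrite -[in RHS]scaleN1r.
have S1 : smooth_fun_at (fun=> -1 : R^o) x by exact: smooth_fun_cst.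
have nS : smooth_fun_at (fun y => (-1 : R^o) *: g y) x by exact: smooth_fun_scale.
have -> : (fun y => f y - g y) = (fun y => f y + (-1 : R^o) *: g y).
  by rewrite funeqE => y; rewrite scaleN1r.
rewrite dfun_add //; congr (_ + _); rewrite (@dfun_scale _ (fun=> -1 : R^o)) //.
by rewrite dfun_cst scale0r add0r.
Qed.

Section LorentzDerivation.
Context {m : nat}.
Notation L := 'cV[R]_(1 + m + 1).

Lemma lorentz_bilinear : bilinear_for
    (GRing.Scale.Law.clone _ _ *:%R _) (GRing.Scale.Law.clone _ _ *:%R _)
    (@lorentz R m : L -> L -> R^o).
Proof.
by split=> [v a x y|a b x y] /=; rewrite !lorentzE.
Qed.
HB.instance Definition _ := bilinear_isBilinear.Build R L L R^o _ _
  (@lorentz R m : L -> L -> R^o) lorentz_bilinear.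

Lemma lorentz_continuous : continuous (fun q : L * L => lorentz q.1 q.2 : R^o).
Proof.
move=> q; have H : smooth_at (fun q : L * L => ((q.1)^T *m gram *m q.2) 0 0 : R^o) q.
  apply: (smooth_at_coord (f := fun q : L * L => (q.1)^T *m gram *m q.2)).
  apply: smooth_at_mulmx; first apply: smooth_at_mulmx; last 1 first.
  - by apply: (@smooth_at_linear _ _ _ _ snd id); [move=> ?; exact: cvg_snd | exact: smooth_at_id].
  - apply: (smooth_at_trmx (f := fst)).
    by apply: (@smooth_at_linear _ _ _ _ fst id); [move=> ?; exact: cvg_fst | exact: smooth_at_id].
  - exact: smooth_at_cst.
exact: smooth_at_continuous H.
Qed.

Lemma smooth_fun_lorentz (f g : M -> L) x : smooth_fun_at f x -> smooth_fun_at g x ->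
  smooth_fun_at (fun y => lorentz (f y) (g y) : R^o) x.
Proof.
exact: (@smooth_at_bilin _ _ _ _ _ (@lorentz R m : L -> L -> R^o) (f \o cinv x) (g \o cinv x) _
  lorentz_continuous).
Qed.

Lemma dfun_lorentz (f g : M -> L) x w : smooth_fun_at f x -> smooth_fun_at g x ->
  dfun (fun y => lorentz (f y) (g y) : R^o) x w
  = lorentz (dfun f x w) (g x) + lorentz (f x) (dfun g x w).
Proof.
by apply: (@dfun_bilin _ _ _ (@lorentz R m : L -> L -> R^o)); exact: lorentz_continuous.
Qed.

End LorentzDerivation.
End Derivations.

(** * Tractors in a frame *)

Section Tractors.
Context {R : realType} {m d : nat} {N : manifold R m.+1} {P : manifold R d}.
Variable C : lightlike_cartan N P.
Notation TN := 'rV[R]_m.+1.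
Notation L := 'cV[R]_(1 + m + 1).
Notation Mat := 'M[R]_(1 + m + 1).
Notation lvec := (@lvec R m).
Notation nvec := (@nvec R m).
Notation p := (proj C).
Notation act := (act C).
Notation om := (omega C).
Notation Hgrp := (@Hgrp R m).
Notation tractor := (tractor C).
Notation psi := (psi C).
Implicit Types (u : P) (x : N) (k : Mat) (s : N -> P) (w : TN) (v f t : L).
Implicit Types (tau : N -> TN -> R^o).

Let PB := cartan_principal C.

Lemma HgrpMV k k' : Hgrp k -> Hgrp k' -> invmx (k *m k') = invmx k' *m invmx k.
Proof.
move=> Hk Hk'; have ku := Hgrp_unit Hk; have ku' := Hgrp_unit Hk'.
have kk := Hgrp_unit (HgrpM Hk Hk').
by rewrite -[RHS](mulKmx kk) -[k *m k' *m _]mulmxA (mulKVmx ku') mulmxV // mulmx1.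
Qed.

Lemma tractor_act u k v : Hgrp k -> tractor (act u k) (invmx k *m v) = tractor u v.
Proof.
move=> Hk; have ku := Hgrp_unit Hk; apply/seteqP; split=> y [k' Hk' ->].
  exists (k *m k'); first exact: HgrpM.
  by rewrite (actM PB _ Hk Hk') HgrpMV // mulmxA.
have Hk2 : Hgrp (invmx k *m k') by apply: HgrpM => //; exact: HgrpV.
exists (invmx k *m k') => //.
rewrite -(actM PB _ Hk Hk2) mulKVmx // HgrpMV //; last exact: HgrpV.
by rewrite invmxK -!mulmxA mulKVmx.
Qed.

Lemma tractor_eq u v u' v' : tractor u v = tractor u' v' ->
  exists k, [/\ Hgrp k, u = act u' k & v = invmx k *m v'].
Proof.
move=> e; have : tractor u v (u, v).
  by exists 1%:M; [exact: Hgrp1 | rewrite (act1 PB) invmx1 mul1mx].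
by rewrite e => -[k Hk [-> ->]]; exists k.
Qed.

Lemma tractor_inj u v v' : tractor u v = tractor u v' -> v = v'.
Proof.
move=> /tractor_eq[k [Hk e ->]]; have -> : k = 1%:M.
  by apply: (@act_inj _ _ _ _ _ C u) => //; [exact: Hgrp1 | rewrite (act1 PB)].
by rewrite invmx1 mul1mx.
Qed.

Lemma tractor_change u u' v : p u = p u' -> exists2 k, Hgrp k &
  u' = act u k /\ tractor u v = tractor u' (invmx k *m v).
Proof.
by move=> /act_transitive[k Hk ->]; exists k => //; rewrite tractor_act.
Qed.

(** The same k relates both pairs of representatives, since the action is free. Hence fibrewise
    operations defined through representatives do not depend on the frame. *)
Lemma tractor_eq2 u v v' u' b b' :
  tractor u v = tractor u' b -> tractor u v' = tractor u' b' ->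
  exists k, [/\ Hgrp k, u = act u' k, v = invmx k *m b & v' = invmx k *m b'].
Proof.
move=> /tractor_eq[k [Hk -> ->]]; rewrite -[RHS](tractor_act _ _ Hk) => /tractor_inj ->.
by exists k.
Qed.

Lemma tmetricE u v v' : tmetric C (tractor u v) (tractor u v') = lorentz v v'.
Proof.
apply: get_unique => [u' b b' e e'|r Hr]; last exact: Hr.
by have [k [Hk _ -> ->]] := tractor_eq2 e e'; rewrite Hgrp_lorentz //; exact: HgrpV.
Qed.

Lemma taddE u v v' : tadd C (tractor u v) (tractor u v') = tractor u (v + v').
Proof.
apply: get_unique => [u' b b' e e'|t Ht]; last exact: Ht.
by have [k [Hk -> -> ->]] := tractor_eq2 e e'; rewrite -mulmxDr tractor_act.
Qed.

Lemma tscaleE u (a : R) v : tscale C a (tractor u v) = tractor u (a *: v).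
Proof.
apply: get_unique => [u' b /tractor_eq[k [Hk -> ->]]|t Ht]; last exact: Ht.
by rewrite scalemxAr tractor_act.
Qed.

Lemma xiE u : xi C (p u) = tractor u lvec.
Proof.
apply: get_unique => [u' e|t Ht]; last exact: Ht.
have [k Hk [-> ->]] := tractor_change lvec (esym e).
by rewrite Hgrp_lvecV.
Qed.

(** Independence of the representative: for s' = s k one has f = k f', and the inhomogeneous term
    k^-1 dk of the gauge change completes k^-1 (k df') to k^-1 d(k f'). *)
Lemma nablaTE (sigma : N -> set (P * L)) s (f : N -> L) x w :
  smooth_map_at s x -> smooth_fun_at f x ->
  (\forall y \near x, p (s y) = y /\ sigma y = tractor (s y) (f y)) ->
  nablaT C sigma x w =
  tractor (s x) (dfun f x w + om (s x) (tangent_map s x w) *m f x).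
Proof.
move=> sS fS sf; apply: get_unique => [s' f' sS' fS' sf'|t Ht]; last exact: Ht.
have ps : \forall y \near x, p (s y) = y by apply: filterS sf => y [].
have ps' : \forall y \near x, p (s' y) = y by apply: filterS sf' => y [].
have [k [kS nk kE]] := section_change sS sS' ps ps'.
have [Hk s'x] := nbhs_singleton nk; have ku := Hgrp_unit Hk.
have nf : \forall y \near x, k y *m f' y = f y.
  apply: filterS3 nk sf sf' => y [Hy e] [_ e1] [_ e2].
  move: e2; rewrite e1 e -{1}(tractor_act _ _ Hy) => /tractor_inj <-.
  by rewrite mulKVmx // Hgrp_unit.
have dE : dfun f x w = dfun k x w *m f' x + k x *m dfun f' x w.
  apply: etrans _ (dfun_mulmx w kS fS').
  exact: dfun_near_eq nf (smooth_fun_mulmx kS fS').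
have fx := nbhs_singleton nf.
rewrite kE s'x -(tractor_act (s x) _ Hk); congr (tractor _ _).
rewrite dE -fx !mulmxDr !mulmxDl !mulmxA mulVmx // mul1mx -!mulmxA.
by rewrite -addrA addrCA; congr (_ + _); exact: addrC.
Qed.

(** In every section xi has the constant representative l, so only the connection term omega l
    remains, and this is psi. *)
Lemma PhiE u w : Phi C (p u) w = tractor u (psi u w).
Proof.
have [s sS] := exists_section C (p u).
have [s1 s2] := nbhs_singleton sS.
have ps : \forall y \near p u, p (s y) = y by apply: filterS sS => y [].
have sxi : \forall y \near p u, p (s y) = y /\ xi C y = tractor (s y) lvec.
  by apply: filterS ps => y e; split=> //; rewrite -{1}e xiE.
apply: etrans (nablaTE w s1 (smooth_fun_cst lvec (p u)) sxi) _.
have -> : dfun (fun=> lvec) (p u) w = 0 by exact: dfun_cst.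
rewrite add0r -(psi_section w s1 ps).
have [k Hk [eu ->]] := tractor_change (psi (s (p u)) w) s2.
have e := psi_act C (s (p u)) w Hk.
have e' : psi (act (s (p u)) k) w = psi u w by rewrite -eu.
by rewrite -e e'.
Qed.

Definition psi_inv u v : TN := get [set w | psi u w = v].

Lemma psi_invK u v : lorentz v lvec = 0 -> psi u (psi_inv u v) = v.
Proof.
move=> /(psi_surj C u)[w wE].
exact: (@getPex _ [set w | psi u w = v] (ex_intro _ w wE)).
Qed.

(* The unique lightlike [f] with [<f, lvec> = 1] and [tau = <psi u, f>]; it
   represents [eta tau] in the frame [u]. *)
Definition dual_vec tau u : L :=
  let T := \col_i (tau (p u) (psi_inv u (evec (delta_mx i 0))) : R) in
  nvec + evec T - (2^-1 * lorentz (evec T) (evec T)) *: lvec.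

Definition dual_null (f : L) := lorentz f f = 0 /\ lorentz f lvec = 1.

(** Each coefficient of [dual_vec] is forced: that of n by tau(Z) = 1, the spatial part T by tau on
    the vectors that psi sends to the e_i, and that of l by nullity, as <f,f> is |T|^2 plus twice
    it. *)
Lemma dual_vecP tau u : linear (tau (p u)) -> tau (p u) (Zfield C (p u)) = 1 ->
  dual_null (dual_vec tau u) /\ forall w, tau (p u) w = lorentz (psi u w) (dual_vec tau u).
Proof.
move=> tl tZ; rewrite /dual_vec; set T := \col_i _.
set q := lorentz (evec T) (evec T).
have [ln nl] : lorentz lvec nvec = 1 /\ lorentz nvec lvec = 1.
  by split; rewrite ?lorentz_lvec_nvec // lorentzC lorentz_lvec_nvec.
have le X : lorentz lvec (evec X) = 0 by rewrite lorentzC lorentz_evec_lvec.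
have ne X : lorentz nvec (evec X) = 0 by rewrite lorentzC lorentz_evec_nvec.
have q2 := (@lorentz_lvec R m, @lorentz_nvec R m, @lorentz_evec_lvec R m,
  @lorentz_evec_nvec R m, ln, nl, le, ne).
split; first by split; rewrite !lorentzE !q2 -?/q; field.
move=> w; have [[a X] wE] := embP (psi_perp C u w).
pose E i := psi_inv u (evec (delta_mx i 0)).
have psE i : psi u (E i) = evec (delta_mx i 0) by rewrite psi_invK // lorentz_evec_lvec.
have sE : psi u (\sum_i X i 0 *: E i) = evec X.
  pose F : {linear TN -> L} := HB.pack (psi u) (GRing.isLinear.Build _ _ _ _ _ (psi_linear C u)).
  pose G : {linear 'cV[R]_m -> L} := HB.pack (@evec R m)
    (GRing.isLinear.Build _ _ _ _ _ (@evec_linear R m)).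
  rewrite -[psi u]/(F : _ -> _) linear_sum -[evec X]/(G X).
  rewrite {2}(matrix_sum_delta X) linear_sum; apply: eq_bigr => i _.
  by rewrite big_ord1 !linearZ /= psE.
(* Z and the E_i correspond under psi to l and the e_i, so the coordinates of psi w are those of w;
   both sides then become a + sum X_i T_i. *)
have -> : w = a *: Zfield C (p u) + \sum_i X i 0 *: E i.
  by apply: (@psi_inj _ _ _ _ _ C u); rewrite psi_linear psi_Zfield wE sE.
pose TT : {linear TN -> R^o} := HB.pack (tau (p u)) (GRing.isLinear.Build _ _ _ _ _ tl).
have -> : tau (p u) (a *: Zfield C (p u) + \sum_i X i 0 *: E i) = a + \sum_i X i 0 * T i 0.
  rewrite tl tZ /GRing.scale /= mulr1; congr (_ + _).
  rewrite -[tau (p u)]/(TT : _ -> _) linear_sum; apply: eq_bigr => i _.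
  by rewrite linearZ /= mxE.
rewrite psi_linear psi_Zfield sE.
rewrite !lorentzE !q2 lorentz_evec mxE; under [in RHS]eq_bigr do rewrite mxE.
ring.
Qed.

End Tractors.

(** * Linear algebra of a null vector paired with l *)

Section NullPairs.
Context {R : realType} {m : nat}.
Notation L := 'cV[R]_(1 + m + 1).
Notation lvec := (@lvec R m).
Implicit Types (v f t : L).

(* the An(tau)-component of a tractor [t], in a frame where [eta tau] is [f] *)
Definition pr f t : L := t - lorentz t f *: lvec - lorentz t lvec *: f.

Lemma pr_perp f t : dual_null f -> lorentz (pr f t) lvec = 0 /\ lorentz (pr f t) f = 0.
Proof.
move=> [ff fl]; rewrite /pr !lorentzE (lorentzC lvec f) fl ff lorentz_lvec.
by split; ring.
Qed.

Lemma pr_id f v : lorentz v lvec = 0 -> lorentz v f = 0 -> pr f v = v.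
Proof. by rewrite /pr => -> ->; rewrite !scale0r !subr0. Qed.

Lemma pr_lvec_perp f v : lorentz v lvec = 0 -> pr f v = v - lorentz v f *: lvec.
Proof. by rewrite /pr => ->; rewrite scale0r subr0. Qed.

Lemma lorentz_pr f t v : lorentz v lvec = 0 -> lorentz v f = 0 ->
  lorentz (pr f t) v = lorentz t v.
Proof.
by move=> vl vf; rewrite /pr !lorentzE (lorentzC lvec v) vl (lorentzC f v) vf !mulr0 !subr0.
Qed.

Lemma pr_linear f : linear (pr f).
Proof.
move=> a v w; rewrite /pr !lorentzE.
by apply/colP => i; rewrite !mxE; ring.
Qed.

Lemma pr_scale f a t : pr f (a *: t) = a *: pr f t.
Proof. by rewrite -[a *: t]addr0 pr_linear (lin0 (pr_linear f)) addr0. Qed.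

Lemma prD f t t' : pr f (t + t') = pr f t + pr f t'.
Proof. by have := pr_linear f 1 t t'; rewrite !scale1r. Qed.

Lemma pr_decomp f v (a b : R) : dual_null f -> lorentz v lvec = 0 -> lorentz v f = 0 ->
  pr f (a *: lvec + v + b *: f) = v.
Proof.
move=> [ff fl] vl vf; rewrite /pr !lorentzE vl vf (lorentzC lvec f) fl ff lorentz_lvec.
by apply/colP => i; rewrite !mxE; ring.
Qed.

Lemma pr_isometry f v w : lorentz v lvec = 0 -> lorentz w lvec = 0 ->
  lorentz (pr f v) (pr f w) = lorentz v w.
Proof.
move=> vl wl; rewrite !pr_lvec_perp // !lorentzE (lorentzC lvec w) vl wl lorentz_lvec.
by ring.
Qed.

(** With g = f' - f, the vector pr_f g is orthogonal to l and f, hence by assumption to f' and to g.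
    So it is null, and therefore zero by definiteness. Then f' = f + a l, and nullity of f' says 2 a
    = 0. *)
Lemma null_unique f f' : dual_null f -> dual_null f' ->
  (forall v, lorentz v lvec = 0 -> lorentz v f = 0 -> lorentz v f' = 0) -> f' = f.
Proof.
move=> Df [f'f' f'l] H; pose g := f' - f; have [ff fl] := Df.
have gl : lorentz g lvec = 0 by rewrite /g !lorentzE f'l fl subrr.
have [vl vf] := pr_perp g Df; have vf' := H _ vl vf.
have vE := pr_lvec_perp f gl.
have vg : lorentz (pr f g) g = 0 by rewrite /g lorentzDr lorentzNr vf' vf subrr.
have vv : lorentz (pr f g) (pr f g) = 0.
  by rewrite {2}vE lorentzDr lorentzNr lorentzZr vg vl mulr0 subrr.
have v0 : pr f g = 0.
  have e := lorentz_perp_eq0 vl vv; rewrite e in vf *.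
  by move: vf; rewrite lorentzZl (lorentzC lvec) fl mulr1 => ->; rewrite scale0r.
have gE : g = lorentz g f *: lvec by apply/eqP; rewrite -subr_eq0 -vE v0.
have f'E : f' = f + lorentz g f *: lvec by rewrite -gE /g addrC subrK.
move: f'f'; rewrite f'E; set a := lorentz g f.
rewrite !lorentzE ff (lorentzC lvec f) fl lorentz_lvec => H2.
have -> : a = 0 by lra.
by rewrite scale0r addr0.
Qed.

(** In the application t is the covariant derivative of V = psi X, q is psi W, c is taub(X), a its
    derivative, and e is h(X,W). The left side projects the derivative of V - c l, the
    representative of P^taub X. *)
Lemma pr_change_nabla f b (t q : L) (a c e : R) : dual_null f -> dual_null b ->
  lorentz q lvec = 0 -> lorentz t lvec = - e ->
  pr b (t - a *: lvec - c *: q) =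
  (pr f t - c *: q) - lorentz (pr f t - c *: q) b *: lvec - e *: pr b f.
Proof.
move=> [ff fl] [bb bl] ql te; rewrite /pr !lorentzE te ql fl lorentz_lvec.
rewrite (lorentzC lvec b) bl.
by apply/colP => i; rewrite !mxE; ring.
Qed.

(** Here t and tb are the covariant derivatives of f and b, and q is psi W. The argument of the last
    projection is the derivative of L = f - b - <f,b> l, with a the derivative of <f,b>. *)
Lemma pr_change_D f b (t tb q : L) (a : R) : dual_null f -> dual_null b ->
  lorentz q lvec = 0 -> lorentz t lvec = - lorentz f q -> lorentz tb lvec = - lorentz b q ->
  pr b tb =
  (pr f t + (2^-1 * lorentz (pr b f) (pr b f)) *: q)
  - lorentz (pr f t + (2^-1 * lorentz (pr b f) (pr b f)) *: q) b *: lvec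
  - lorentz q f *: pr b f - pr b (t - tb - a *: lvec - lorentz f b *: q).
Proof.
move=> [ff fl] [bb bl] ql te tbe; rewrite /pr !lorentzE te tbe ql ff fl bb bl lorentz_lvec.
rewrite (lorentzC lvec b) (lorentzC lvec f) bl fl (lorentzC b f) (lorentzC q f) (lorentzC q b).
by apply/colP => i; rewrite !mxE; field.
Qed.

(** Completeness of m orthonormal vectors. Modulo l they are the rows of a square matrix Q with Q
    Q^T = 1, hence also Q^T Q = 1, so the remainder of the expansion, orthogonal to every E_i, is a
    multiple of l. Pairing with f shows that this multiple is zero. *)
Lemma frame_expansion f (E : 'I_m -> L) r : dual_null f ->
  (forall i, lorentz (E i) lvec = 0) -> (forall i, lorentz (E i) f = 0) ->
  (forall i j, lorentz (E i) (E j) = (i == j)%:R) ->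
  lorentz r lvec = 0 -> lorentz r f = 0 -> r = \sum_i lorentz (E i) r *: E i.
Proof.
move=> [ff fl] El Ef EE rl rf; apply/eqP; rewrite -subr_eq0; apply/eqP.
set g := r - _.
have gl : lorentz g lvec = 0.
  rewrite /g !lorentzE lorentz_suml big1 ?rl ?subrr // => i _.
  by rewrite lorentzZl El mulr0.
have gf : lorentz g f = 0.
  rewrite /g !lorentzE lorentz_suml big1 ?rf ?subrr // => i _.
  by rewrite lorentzZl Ef mulr0.
have gE j : lorentz (E j) g = 0.
  rewrite /g lorentzDr lorentzNr (lorentzC _ (\sum_i _)) lorentz_suml (bigD1 j) //= big1.
    by rewrite lorentzZl EE eqxx mulr1 addr0 subrr.
  by move=> i ij; rewrite lorentzZl EE (negPf ij) mulr0.
have [[a Y] gY] := embP gl.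
have EX i : exists y, E i = emb y by exact: embP.
have [X XE] := choice EX.
pose Q : 'M[R]_m := \matrix_i ((X i).2)^T.
have QQ : Q *m Q^T = 1%:M.
  apply/matrixP => i j; have := EE i j; rewrite !XE lorentz_emb /qform !mxE => <-.
  by apply: eq_bigr => k _; rewrite !mxE.
have QY : Q *m Y = 0.
  apply/colP => i; have := gE i; rewrite XE gY lorentz_emb /qform !mxE => e.
  by rewrite -[RHS]e; apply: eq_bigr => k _; rewrite !mxE.
have Y0 : Y = 0 by rewrite -[Y]mul1mx -(mulmx1C QQ) -mulmxA QY mulmx0.
have ga : g = a *: lvec by rewrite gY /emb /= Y0 (lin0 (@evec_linear R m)) addr0.
by move: gf; rewrite ga lorentzZl (lorentzC lvec) fl mulr1 => ->; rewrite scale0r.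
Qed.

End NullPairs.

(** * Weyl structures in a frame *)

Section Weyl.
Context {R : realType} {m d : nat} {N : manifold R m.+1} {P : manifold R d}.
Variable C : lightlike_cartan N P.
Notation TN := 'rV[R]_m.+1.
Notation L := 'cV[R]_(1 + m + 1).
Notation Mat := 'M[R]_(1 + m + 1).
Notation lvec := (@lvec R m).
Notation nvec := (@nvec R m).
Notation p := (proj C).
Notation act := (act C).
Notation om := (omega C).
Notation tractor := (tractor C).
Notation psi := (psi C).
Notation dual_vec := (dual_vec C).
Notation psi_inv := (psi_inv C).
Implicit Types (u : P) (x : N) (s : N -> P) (w : TN) (v f t : L).
Implicit Types (tau : N -> TN -> R^o).

Lemma Sforms_dual tau u : Sforms C tau ->
  dual_null (dual_vec tau u) /\ forall w, tau (p u) w = lorentz (psi u w) (dual_vec tau u).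
Proof. by case=> [[tl _] tZ]; apply: dual_vecP. Qed.

Lemma etaE tau u : Sforms C tau -> Defs.eta C tau (p u) = tractor u (dual_vec tau u).
Proof.
move=> /(@Sforms_dual _ u)[Df tE]; have [ff fl] := Df.
apply: get_unique.
  split; first by exists u, (dual_vec tau u).
  - by rewrite tmetricE.
  - by rewrite xiE tmetricE lorentzC.
  - by move=> v tv; rewrite PhiE tmetricE -tE.
move=> t [[u' [v' [e ->]]]].
have [k Hk [_ ->]] := tractor_change v' e; set v := invmx k *m v'.
rewrite xiE !tmetricE => vv lv H; congr (tractor _ _).
apply: null_unique => //; first by split=> //; rewrite lorentzC.
move=> b bl bf; have [w wb] := psi_surj C u bl.
by have := H w; rewrite PhiE tmetricE tE wb; apply.
Qed.

Lemma An_componentE tau u t : Sforms C tau ->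
  psi u (An_component C tau (p u) (tractor u t)) = pr (dual_vec tau u) t.
Proof.
move=> St; have [Df tE] := Sforms_dual u St; have [ff fl] := Df.
set f := dual_vec tau u in Df tE ff fl *.
have [prl prf] := pr_perp t Df.
have [X0 X0E] := psi_surj C u prl.
rewrite -[RHS]X0E; congr (psi u _).
have dec X (a b : R) : tadd C (tadd C (tscale C a (xi C (p u))) (Phi C (p u) X))
    (tscale C b (Defs.eta C tau (p u))) = tractor u (a *: lvec + psi u X + b *: f).
  by rewrite xiE PhiE etaE // !tscaleE !taddE.
apply: get_unique.
  split; first by rewrite tE X0E.
  (* Since l and f are null with <l,f> = 1, pairing with f gives the coefficient of l and pairing
     with l gives that of f. *)
  exists (lorentz t f), (lorentz t lvec); rewrite dec X0E; congr (tractor _ _).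
  by rewrite /pr; apply/colP => i; rewrite !mxE; ring.
move=> X [tX [a [b]]]; rewrite dec => /tractor_inj e.
apply: (@psi_inj _ _ _ _ _ C u); rewrite X0E e pr_decomp //; first exact: psi_perp.
by rewrite -tE.
Qed.

Lemma PprojE tau u w : Sforms C tau ->
  psi u (Pproj C tau (p u) w) = psi u w - lorentz (psi u w) (dual_vec tau u) *: lvec.
Proof.
move=> St; have [_ tE] := Sforms_dual u St.
by rewrite /Pproj -scaleNr addrC psi_linear psi_Zfield tE addrC scaleNr.
Qed.

Lemma psi0 u : psi u 0 = 0. Proof. exact: lin0 (psi_linear C u). Qed.
Lemma psiD u w w' : psi u (w + w') = psi u w + psi u w'.
Proof. by have := psi_linear C u 1 w w'; rewrite !scale1r. Qed.
Lemma psiZ u (a : R) w : psi u (a *: w) = a *: psi u w.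
Proof. by have := psi_linear C u a w 0; rewrite !addr0 psi0 addr0. Qed.
Lemma psiN u w : psi u (- w) = - psi u w.
Proof. by rewrite -scaleN1r psiZ scaleN1r. Qed.
Lemma psiB u w w' : psi u (w - w') = psi u w - psi u w'.
Proof. by rewrite psiD psiN. Qed.
Lemma psi_sum u (F : 'I_m -> TN) : psi u (\sum_i F i) = \sum_i psi u (F i).
Proof. by elim/big_rec2: _ => [|i a b _ <-]; [exact: psi0 | rewrite psiD]. Qed.

(** In a frame E of An(taub) the coefficients tau(E_i) are <psi E_i, f>. They do not change when f
    is replaced by its projection pr_b f, which is therefore the sum defining L, whatever the
    frame. *)
Lemma LfieldE tau taub u : Sforms C tau -> Sforms C taub ->
  psi u (Lfield C tau taub (p u)) = pr (dual_vec taub u) (dual_vec tau u).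
Proof.
move=> St Sb; have [Df tE] := Sforms_dual u St; have [Db bE] := Sforms_dual u Sb.
set f := dual_vec tau u in Df tE *; set b := dual_vec taub u in Db bE *.
have [ff fl] := Df; have [bb bl] := Db.
have [prl prb] := pr_perp f Db.
have [y0 y0E] := psi_surj C u prl.
have main (E : 'I_m -> TN) : (forall i, taub (p u) (E i) = 0) ->
    (forall i j, hmetric C (p u) (E i) (E j) = (i == j)%:R) ->
    y0 = \sum_i tau (p u) (E i) *: E i.
  move=> Eb EE; apply: (@psi_inj _ _ _ _ _ C u); rewrite y0E psi_sum.
  have Ef i : lorentz (psi u (E i)) b = 0 by rewrite -bE.
  rewrite [LHS](@frame_expansion _ _ b (fun i => psi u (E i))) //.
  - apply: eq_bigr => i _; rewrite psiZ tE; congr (_ *: _).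
    by rewrite lorentzC lorentz_pr ?psi_perp // lorentzC.
  - by move=> i; exact: psi_perp.
  - by move=> i j; rewrite -hmetricE.
rewrite -[RHS]y0E; congr (psi u _); apply: get_unique => // y Hy.
(* The description of L constrains its value only if an orthonormal frame exists. As pr_b is
   isometric on the hyperplane orthogonal to l, the projected e_i form one. *)
pose E0 i := psi_inv u (pr b (evec (delta_mx i 0))).
have pE i : psi u (E0 i) = pr b (evec (delta_mx i 0)).
  by rewrite psi_invK //; have [] := pr_perp (evec (delta_mx i 0)) Db.
have Eb i : taub (p u) (E0 i) = 0.
  by rewrite bE pE; have [] := pr_perp (evec (delta_mx i 0)) Db.
have EE i j : hmetric C (p u) (E0 i) (E0 j) = (i == j)%:R.
  rewrite hmetricE !pE pr_isometry ?lorentz_evec_lvec // lorentz_evec trmx_delta.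
  rewrite mul_delta_mx_cond mulmxnE !mxE !eqxx /=. by case: (i == j).
by rewrite (Hy E0 Eb EE) -(main E0 Eb EE).
Qed.

Section LocalFrame.
Variables (x : N) (s : N -> P).
Hypothesis sS : \forall y \near x, smooth_map_at s y /\ p (s y) = y.

Definition conn y w : Mat := om (s y) (tangent_map s y w).

Lemma conn_form : smooth_form_at conn x.
Proof.
by apply: pullback_form (omega_smooth C) _; apply: filterS sS => y [].
Qed.

Lemma conn_psi : \forall y \near x, forall w, conn y w *m lvec = psi (s y) w.
Proof.
(* [psi_section] at y needs the section identity around y, not only at y; on the interior of this
   set it holds around every point. *)
have /nbhs_interior H : nbhs x [set y | smooth_map_at s y /\ p (s y) = y] by exact: sS.
apply: filterS H => y Hy w; have [s1 _] := nbhs_singleton Hy.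
by rewrite (psi_section w s1) //; apply: filterS Hy => z [].
Qed.

Lemma solder_form : smooth_form_at (fun y w => conn y w *m lvec) x.
Proof.
have [cl cS] := conn_form; split=> [|v].
  by apply: filterS cl => y cl a v w; rewrite cl mulmxDl scalemxAl.
exact: smooth_fun_mulmx (cS v) (smooth_fun_cst _ _).
Qed.

Lemma psi_smooth (X : vfield N) : smooth_vfield_at X x ->
  smooth_fun_at (fun y => psi (s y) (X y)) x.
Proof.
move=> XS; apply: smooth_fun_near_eq (form_apply solder_form XS).
by apply: filterS conn_psi => y ->.
Qed.

Lemma perp_coord_smooth (V : N -> L) :
  smooth_fun_at V x -> smooth_fun_at (fun y => perp_coord (V y)) x.
Proof.
move=> VS; apply: smooth_fun_trmx; apply: smooth_fun_mx => i j.
apply: smooth_at_ext (smooth_fun_coord (lshift 1 i) j VS) => z.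
by rewrite /= mxE.
Qed.

(** The solder form followed by [perp_coord] is a smooth coframe, so smoothness of a vector field
    can be read off its Lorentz-valued representative. The vector fields constructed from omega are
    shown smooth in this way. *)
Lemma vfield_smooth (X : vfield N) (V : N -> L) : smooth_fun_at V x ->
  (\forall y \near x, psi (s y) (X y) = V y) -> smooth_vfield_at X x.
Proof.
move=> VS XV; have [cl cS] := solder_form.
have BS : smooth_form_at (fun y w => perp_coord (conn y w *m lvec)) x.
  split=> [|v]; last exact: perp_coord_smooth (cS v).
  by apply: filterS cl => y cl a v w; rewrite cl perp_coord_linear.
apply: (coframe_smooth BS) => [v w|].
  by rewrite !(nbhs_singleton conn_psi); exact: psi_coord_inj.
apply: smooth_fun_near_eq (perp_coord_smooth VS).
by apply: filterS2 XV conn_psi => y <- ->.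
Qed.

(** The fields on which [dual_vec] evaluates tau have constant representatives e_i, hence are
    smooth; the rest is polynomial in their values under tau. *)
Lemma dual_smooth tau : Sforms C tau -> smooth_fun_at (fun y => dual_vec tau (s y)) x.
Proof.
move=> [[tl tS] _].
have tF : smooth_form_at tau x by split; [exact: nearW | exact: tS].
have ES i : smooth_fun_at (fun y => tau y (psi_inv (s y) (evec (delta_mx i 0))) : R^o) x.
  apply: form_apply tF _.
  apply: (vfield_smooth (smooth_fun_cst (evec (delta_mx i 0) : L) x)).
  by apply: nearW => y; rewrite psi_invK // lorentz_evec_lvec.
have TS : smooth_fun_at (fun y => \sum_i (tau y (psi_inv (s y) (evec (delta_mx i 0))) : R^o) *:
    (evec (delta_mx i 0) : L)) x.
  by apply: smooth_fun_sum => i; apply: smooth_fun_scale => //; exact: smooth_fun_cst.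
have DS : smooth_fun_at (fun y =>
    let T := \sum_i (tau y (psi_inv (s y) (evec (delta_mx i 0))) : R^o) *:
      (evec (delta_mx i 0) : L) in
    nvec + T - (2^-1 * lorentz T T : R^o) *: lvec) x.
  apply: smooth_fun_sub.
    by apply: smooth_fun_add => //; exact: smooth_fun_cst.
  apply: smooth_fun_scale; last exact: smooth_fun_cst.
  apply: smooth_fun_mul; first exact: smooth_fun_cst.
  exact: smooth_fun_lorentz.
apply: smooth_fun_near_eq DS; apply: filterS sS => y [_ py].
have e : evec (\col_i (tau (p (s y)) (psi_inv (s y) (evec (delta_mx i 0))) : R)) =
   \sum_i (tau y (psi_inv (s y) (evec (delta_mx i 0))) : R^o) *: (evec (delta_mx i 0) : L).
  rewrite py; pose G : {linear 'cV[R]_m -> L} :=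
    HB.pack (@evec R m) (GRing.isLinear.Build _ _ _ _ _ (@evec_linear R m)).
  rewrite -[evec (\col__ _)]/(G _) [X in G X]matrix_sum_delta linear_sum.
  by apply: eq_bigr => i _; rewrite big_ord1 linearZ /= mxE.
by rewrite /dual_vec e.
Qed.

Lemma pr_smooth (f t : N -> L) : smooth_fun_at f x -> smooth_fun_at t x ->
  smooth_fun_at (fun y => pr (f y) (t y)) x.
Proof.
move=> fS tS; have lS := smooth_fun_cst (lvec : L) x.
apply: smooth_fun_sub.
  apply: smooth_fun_sub => //; apply: smooth_fun_scale => //.
  exact: smooth_fun_lorentz.
by apply: smooth_fun_scale => //; exact: smooth_fun_lorentz.
Qed.

Lemma nablaCE tau W X : Sforms C tau -> smooth_vfield_at X x ->
  psi (s x) (nablaC C tau W X x) = pr (dual_vec tau (s x))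
    (dfun (fun y => psi (s y) (X y)) x (W x) + conn x (W x) *m psi (s x) (X x)).
Proof.
move=> St XS; have [s1 s2] := nbhs_singleton sS.
have ps : \forall y \near x, p (s y) = y /\ Phi C y (X y) = tractor (s y) (psi (s y) (X y)).
  by apply: filterS sS => y [_ py]; split=> //; rewrite -{1}py PhiE.
rewrite /nablaC (nablaTE (W x) s1 (psi_smooth XS) ps).
by rewrite -[X in An_component _ _ X]s2 An_componentE.
Qed.

Lemma DCE tau w : Sforms C tau ->
  psi (s x) (DC C tau x w) = pr (dual_vec tau (s x))
    (dfun (fun y => dual_vec tau (s y)) x w + conn x w *m dual_vec tau (s x)).
Proof.
move=> St; have [s1 s2] := nbhs_singleton sS.
have ps : \forall y \near x, p (s y) = y /\ Defs.eta C tau y = tractor (s y) (dual_vec tau (s y)).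
  by apply: filterS sS => y [_ py]; split=> //; rewrite -{1}py etaE.
rewrite /DC (nablaTE w s1 (dual_smooth St) ps).
by rewrite -[X in An_component _ _ X]s2 An_componentE.
Qed.

End LocalFrame.
End Weyl.

(** * Transformation rules *)

Section WeylTransformation.
Context {R : realType} {m d : nat} {N : manifold R m.+1} {P : manifold R d}.
Variable C : lightlike_cartan N P.
Notation TN := 'rV[R]_m.+1.
Notation L := 'cV[R]_(1 + m + 1).
Notation lvec := (@lvec R m).
Notation p := (proj C).
Notation psi := (psi C).
Notation dual_vec := (dual_vec C).
Notation conn := (conn C).
Implicit Types (u : P) (x : N) (s : N -> P) (w : TN).
Implicit Types (tau : N -> TN -> R^o).

Lemma hmetric_at x v w u : p u = x -> hmetric C x v w = lorentz (psi u v) (psi u w).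
Proof. by move=> <-; exact: hmetricE. Qed.

Lemma Zfield_at x u : p u = x -> psi u (Zfield C x) = lvec.
Proof. by move=> <-; exact: psi_Zfield. Qed.

Lemma tau_at tau x u w : Sforms C tau -> p u = x -> tau x w = lorentz (psi u w) (dual_vec tau u).
Proof. by move=> /(@Sforms_dual _ _ _ _ _ C _ u)[_ H] <-. Qed.

Lemma dual_null_at tau u : Sforms C tau -> dual_null (dual_vec tau u).
Proof. by move=> /(@Sforms_dual _ _ _ _ _ C _ u)[]. Qed.

Lemma PprojE_at tau x u w : Sforms C tau -> p u = x ->
  psi u (Pproj C tau x w) = psi u w - lorentz (psi u w) (dual_vec tau u) *: lvec.
Proof. by move=> St <-; exact: PprojE. Qed.

Lemma LfieldE_at tau taub x u : Sforms C tau -> Sforms C taub -> p u = x ->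
  psi u (Lfield C tau taub x) = pr (dual_vec taub u) (dual_vec tau u).
Proof. by move=> St Sb <-; exact: LfieldE. Qed.

Lemma Zfield_spans x : spans (Zfield C x) (radical (hmetric C) x).
Proof.
have [s sS] := exists_section C x; have [_ sx] := nbhs_singleton sS.
have Zx := Zfield_at sx.
have l0 : lvec != 0.
  apply/eqP => l0; have := @lorentz_lvec_nvec R m.
  by rewrite l0 lorentz0l => /eqP; rewrite eq_sym oner_eq0.
split; first by apply: contra_neq l0 => e; rewrite -Zx e psi0.
apply/seteqP; split=> w /=.
  move=> Hw; have := Hw w; rewrite (hmetric_at _ _ sx) => ww.
  have e := lorentz_perp_eq0 (psi_perp C (s x) w) ww.
  exists (lorentz (psi (s x) w) (@nvec R m)); apply: (@psi_inj _ _ _ _ _ C (s x)).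
  by rewrite psiZ Zx.
move=> [c ->] v; rewrite (hmetric_at _ _ sx) psiZ Zx lorentzZl lorentzC psi_perp.
by rewrite mulr0.
Qed.

Lemma hmetric_lightlike : lightlike_metric (hmetric C).
Proof.
split.
- split.
  + move=> x v a w w'; have [s sS] := exists_section C x; have [_ sx] := nbhs_singleton sS.
    by rewrite !(hmetric_at _ _ sx) psi_linear lorentzDr lorentzZr.
  + move=> x v w; have [s sS] := exists_section C x; have [_ sx] := nbhs_singleton sS.
    by rewrite !(hmetric_at _ _ sx) lorentzC.
  move=> x v w; have [s sS] := exists_section C x.
  have [_ HS] := solder_form sS.
  apply: smooth_fun_near_eq (smooth_fun_lorentz (HS v) (HS w)).
  by apply: filterS2 sS (conn_psi sS) => y [_ sy] E; rewrite !E (hmetric_at _ _ sy).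
- move=> x v; have [s sS] := exists_section C x; have [_ sx] := nbhs_singleton sS.
  by rewrite (hmetric_at _ _ sx) lorentz_perp_ge0 // psi_perp.
- by move=> x; exists (Zfield C x); exact: Zfield_spans.
Qed.

Lemma Zfield_smooth : smooth_vfield (Zfield C).
Proof.
move=> x; have [s sS] := exists_section C x.
apply: (vfield_smooth sS (smooth_fun_cst (lvec : L) x)).
by apply: filterS sS => y [_ sy]; exact: Zfield_at.
Qed.

(** The tractor connection is metric: omega takes values in the skew matrices g, so the two
    connection terms cancel. Taking V' = l also gives the l-pairing of a covariant derivative. *)
Lemma covariant_lorentz s x (V V' : N -> L) w : 
  smooth_fun_at V x -> smooth_fun_at V' x ->
  dfun (fun y => lorentz (V y) (V' y) : R^o) x w =
  lorentz (dfun V x w + conn s x w *m V x) (V' x)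
  + lorentz (V x) (dfun V' x w + conn s x w *m V' x).
Proof.
move=> VS VS'; rewrite dfun_lorentz // lorentzDl lorentzDr.
rewrite (lorentz_skew _ _ (galg_skew (omega_galg C _ _))).
by rewrite addrACA addNr addr0.
Qed.

Lemma nabla_smooth tau W X : Sforms C tau -> smooth_vfield W -> smooth_vfield X ->
  smooth_vfield (nablaC C tau W X).
Proof.
move=> St WS XS x; have [s sS] := exists_section C x.
pose V y := psi (s y) (X y).
have VS : smooth_fun_at V x := psi_smooth sS (XS x).
have H : smooth_fun_at (fun y => pr (dual_vec tau (s y))
    (dfun V y (W y) + conn s y (W y) *m V y)) x.
  apply: pr_smooth; first exact: dual_smooth.
  apply: smooth_fun_add; first exact: form_apply (dfun_form VS) (WS x).
  by apply: smooth_fun_mulmx VS; exact: form_apply (conn_form sS) (WS x).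
apply: (vfield_smooth sS H).
have /nbhs_interior nS : nbhs x [set y | smooth_map_at s y /\ p (s y) = y] by exact: sS.
by apply: filterS nS => y sSy; rewrite (nablaCE sSy _ St (XS y)).
Qed.

Lemma nabla_An tau W X : Sforms C tau -> smooth_vfield X -> forall x,
  tau x (nablaC C tau W X x) = 0.
Proof.
move=> St XS x; have [s sS] := exists_section C x; have [_ sx] := nbhs_singleton sS.
rewrite (tau_at _ St sx) (nablaCE sS _ St (XS x)).
by have [] := pr_perp (dfun (fun y => psi (s y) (X y)) x (W x) +
  conn s x (W x) *m psi (s x) (X x)) (dual_null_at (s x) St).
Qed.

Lemma DC_smooth tau W : Sforms C tau -> smooth_vfield W ->
  smooth_vfield (fun x => DC C tau x (W x)).
Proof.
move=> St WS x; have [s sS] := exists_section C x.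
have VS := dual_smooth sS St.
have H : smooth_fun_at (fun y => pr (dual_vec tau (s y))
   (dfun (fun y => dual_vec tau (s y)) y (W y) + conn s y (W y) *m dual_vec tau (s y))) x.
  apply: pr_smooth => //.
  apply: smooth_fun_add; first exact: form_apply (dfun_form VS) (WS x).
  by apply: smooth_fun_mulmx VS; exact: form_apply (conn_form sS) (WS x).
apply: (vfield_smooth (X := fun x => DC C tau x (W x)) sS H).
have /nbhs_interior nS : nbhs x [set y | smooth_map_at s y /\ p (s y) = y] by exact: sS.
by apply: filterS nS => y sSy; rewrite (DCE sSy _ St).
Qed.

Lemma nabla_metric_connection tau : Sforms C tau -> metric_connection C tau (nablaC C tau).
Proof.
move=> St; split.
- move=> W X WS [XS _]; split; first exact: nabla_smooth.
  exact: nabla_An.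
- move=> f W W' X fS WS WS' [XS _] x.
  have [s sS] := exists_section C x; apply: (@psi_inj _ _ _ _ _ C (s x)).
  rewrite psi_linear !(nablaCE sS _ St (XS x)) -pr_linear; congr (pr _ _).
  rewrite dfun_linear (nbhs_singleton (conn_form sS).1) mulmxDl -scalemxAl.
  by rewrite scalerDr addrACA.
- move=> W X X' WS [XS _] [XS' _] x.
  have [s sS] := exists_section C x; apply: (@psi_inj _ _ _ _ _ C (s x)).
  have VS := psi_smooth sS (XS x); have VS' := psi_smooth sS (XS' x).
  have XXS : smooth_vfield_at (fun y => X y + X' y) x.
    apply: (vfield_smooth sS (smooth_fun_add VS VS')).
    by apply: filterE => y; rewrite psiD.
  apply: etrans (nablaCE sS _ St XXS) _; rewrite [RHS]psiD.
  apply: etrans _ (congr2 +%R (esym (nablaCE sS _ St (XS x))) (esym (nablaCE sS _ St (XS' x)))).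
  apply: etrans _ (prD _ _ _); apply: (congr1 (pr _)).
  have e : dfun (fun y => psi (s y) (X y + X' y)) x (W x) =
      dfun (fun y => psi (s y) (X y)) x (W x) + dfun (fun y => psi (s y) (X' y)) x (W x).
    apply: etrans _ (dfun_add (W x) VS VS'); apply: (congr1 (fun h => dfun h x (W x))).
    by rewrite funeqE => y; rewrite psiD.
  by rewrite e psiD mulmxDr addrACA.
- move=> f W X fS WS [XS Xtau] x.
  have [s sS] := exists_section C x; apply: (@psi_inj _ _ _ _ _ C (s x)).
  have [_ sx] := nbhs_singleton sS; have VS := psi_smooth sS (XS x).
  have fXS : smooth_vfield_at (fun y => f y *: X y) x.
    apply: (vfield_smooth sS (smooth_fun_scale (fS x) VS)).
    by apply: filterE => y; rewrite psiZ.
  apply: etrans (nablaCE sS _ St fXS) _; rewrite [RHS]psiD 2![in RHS]psiZ.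
  apply: etrans _ (congr1 (fun t => _ + f x *: t) (esym (nablaCE sS _ St (XS x)))).
  have e : dfun (fun y => psi (s y) (f y *: X y)) x (W x) =
      dfun f x (W x) *: psi (s x) (X x) + f x *: dfun (fun y => psi (s y) (X y)) x (W x).
    apply: etrans _ (dfun_scale (W x) (fS x) VS); apply: (congr1 (fun h => dfun h x (W x))).
    by rewrite funeqE => y; rewrite psiZ.
  (* The Leibniz term df(W) X survives the projection unchanged because X lies in An(tau). *)
  have Xf : lorentz (psi (s x) (X x)) (dual_vec tau (s x)) = 0 by rewrite -(tau_at _ St sx).
  rewrite e psiZ -scalemxAr -addrA -scalerDr prD !pr_scale.
  by rewrite (pr_id (psi_perp C (s x) (X x)) Xf).
- move=> W X Y WS [XS Xtau] [YS Ytau] x.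
  have [s sS] := exists_section C x; have [_ sx] := nbhs_singleton sS.
  have VS := psi_smooth sS (XS x); have VS' := psi_smooth sS (YS x).
  have e : dfun (fun y => hmetric C y (X y) (Y y) : R^o) x (W x) =
      dfun (fun y => lorentz (psi (s y) (X y)) (psi (s y) (Y y)) : R^o) x (W x).
    apply: dfun_near_eq; last exact: smooth_fun_lorentz.
    by apply: filterS sS => y [_ sy]; rewrite (hmetric_at _ _ sy).
  apply: etrans e _; apply: etrans (covariant_lorentz s _ VS VS') _.
  rewrite !(hmetric_at _ _ sx).
  have eX := nablaCE sS W St (XS x); have eY := nablaCE sS W St (YS x).
  apply: etrans _ (congr2 +%R (congr1 (lorentz^~ _) (esym eX)) (congr1 (lorentz _) (esym eY))).
  have Xf : lorentz (psi (s x) (X x)) (dual_vec tau (s x)) = 0 by rewrite -(tau_at _ St sx).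
  have Yf : lorentz (psi (s x) (Y x)) (dual_vec tau (s x)) = 0 by rewrite -(tau_at _ St sx).
  rewrite lorentz_pr ?psi_perp //; congr (_ + _).
  by rewrite [RHS]lorentzC lorentz_pr ?psi_perp // lorentzC.
Qed.

Lemma DC_bundle_morphism tau : Sforms C tau -> An_bundle_morphism tau (DC C tau).
Proof.
move=> St; split.
- move=> x a w w'; have [s sS] := exists_section C x; apply: (@psi_inj _ _ _ _ _ C (s x)).
  rewrite psi_linear !(DCE sS _ St) -pr_linear; congr (pr _ _).
  rewrite dfun_linear (nbhs_singleton (conn_form sS).1) mulmxDl -scalemxAl.
  by rewrite scalerDr addrACA.
- move=> x w; have [s sS] := exists_section C x; have [_ sx] := nbhs_singleton sS.
  rewrite (tau_at _ St sx) (DCE sS _ St).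
  by have [] := pr_perp (dfun (fun y => dual_vec tau (s y)) x w +
    conn s x w *m dual_vec tau (s x)) (dual_null_at (s x) St).
- by move=> W WS; exact: DC_smooth.
Qed.

Lemma nabla_transformation tau taub W X x : Sforms C tau -> Sforms C taub ->
  An_section tau X -> smooth_vfield W ->
  nablaC C taub W (fun y => Pproj C taub y (X y)) x
  = Pproj C taub x (nablaC C tau W X x - taub x (X x) *: W x)
    - hmetric C x (X x) (W x) *: Lfield C tau taub x.
Proof.
move=> St Sb [XS Xtau] WS.
have [s sS] := exists_section C x; have [_ sx] := nbhs_singleton sS.
apply: (@psi_inj _ _ _ _ _ C (s x)).
pose V y := psi (s y) (X y); pose f y := dual_vec tau (s y); pose fb y := dual_vec taub (s y).
have VS : smooth_fun_at V x := psi_smooth sS (XS x).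
have fS : smooth_fun_at f x := dual_smooth sS St.
have fbS : smooth_fun_at fb x := dual_smooth sS Sb.
pose c y : R^o := lorentz (V y) (fb y).
have cS : smooth_fun_at c x := smooth_fun_lorentz VS fbS.
have lS : smooth_fun_at (fun=> lvec : L) x := smooth_fun_cst _ _.
have clS := smooth_fun_scale cS lS.
have VbS := smooth_fun_sub VS clS.
(* Changing from X to P^taub X subtracts a multiple of l with varying coefficient c = taub(X). Its
   derivative adds a multiple of l, which the projection kills, and c A l = c psi W, which gives the
   term taub(X) W. *)
have nV : \forall y \near x, V y - c y *: lvec = psi (s y) (Pproj C taub y (X y)).
  by apply: filterS sS => y [_ sy]; rewrite (PprojE_at _ Sb sy).
have XbS : smooth_vfield_at (fun y => Pproj C taub y (X y)) x.
  by apply: (vfield_smooth sS VbS); apply: filterS nV => y ->.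
apply: etrans (nablaCE sS _ Sb XbS) _.
have e : dfun (fun y => psi (s y) (Pproj C taub y (X y))) x (W x) =
    dfun V x (W x) - dfun c x (W x) *: lvec.
  apply: etrans (dfun_near_eq _ nV VbS) _.
  apply: etrans (dfun_sub _ VS clS) _; congr (_ - _).
  apply: etrans (dfun_scale _ cS lS) _.
  have -> : dfun (fun=> lvec : L) x (W x) = 0 by exact: dfun_cst.
  by rewrite scaler0 addr0.
rewrite e -(nbhs_singleton nV); apply/esym.
have eN := nablaCE sS W St (XS x); have eW := nbhs_singleton (conn_psi sS) (W x).
rewrite psiB psiZ (PprojE_at _ Sb sx) (LfieldE_at St Sb sx) psiB psiZ.
rewrite (tau_at _ Sb sx) (hmetric_at _ _ sx) eN.
rewrite -/(V x) -/(f x) -/(fb x) -/(c x); apply/esym.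
set A := conn s x (W x) in eW *; set q := psi (s x) (W x) in eW *.
set dV := dfun V x (W x); set dc := dfun c x (W x).
have -> : dV - dc *: lvec + A *m (V x - c x *: lvec) =
    (dV + A *m V x) - dc *: lvec - c x *: q.
  by rewrite mulmxBr -scalemxAr eW addrACA addrA.
apply: pr_change_nabla; [exact: dual_null_at | exact: dual_null_at | exact: psi_perp |].
(* Differentiating <V,l> = 0 gives <DV,l> = - <V, psi W>, the source of the term in h(X,W). *)
have := covariant_lorentz s (W x) VS lS; rewrite -/A -/dV.
have -> : dfun (fun y => lorentz (V y) lvec : R^o) x (W x) = 0.
  by apply: (@dfun_near_cst _ _ _ _ _ 0); apply: filterE => y; exact: psi_perp.
have -> : dfun (fun=> lvec : L) x (W x) = 0 by exact: dfun_cst.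
by rewrite add0r eW => /eqP; rewrite eq_sym addr_eq0 => /eqP.
Qed.

Lemma D_transformation tau taub W x : Sforms C tau -> Sforms C taub ->
  smooth_vfield W ->
  DC C taub x (W x)
  = Pproj C taub x (DC C tau x (W x)
      + (2^-1 * hmetric C x (Lfield C tau taub x) (Lfield C tau taub x)) *: W x)
    - tau x (W x) *: Lfield C tau taub x - nablaC C taub W (Lfield C tau taub) x.
Proof.
move=> St Sb WS.
have [s sS] := exists_section C x; have [_ sx] := nbhs_singleton sS.
apply: (@psi_inj _ _ _ _ _ C (s x)).
pose f y := dual_vec tau (s y); pose fb y := dual_vec taub (s y).
have fS : smooth_fun_at f x := dual_smooth sS St.
have fbS : smooth_fun_at fb x := dual_smooth sS Sb.
pose c y : R^o := lorentz (f y) (fb y).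
have cS : smooth_fun_at c x := smooth_fun_lorentz fS fbS.
have lS : smooth_fun_at (fun=> lvec : L) x := smooth_fun_cst _ _.
have clS := smooth_fun_scale cS lS.
have ffS := smooth_fun_sub fS fbS.
have LS := smooth_fun_sub ffS clS.
(* This representative gives at once the smoothness of L, required to evaluate nabla^taub on it, and
   its derivative. *)
have nL : \forall y \near x, f y - fb y - c y *: lvec = psi (s y) (Lfield C tau taub y).
  apply: filterS sS => y [_ sy]; rewrite (LfieldE_at St Sb sy) /pr.
  by have [_ ->] := dual_null_at (s y) St; rewrite scale1r addrAC.
have LfS : smooth_vfield_at (Lfield C tau taub) x.
  by apply: (vfield_smooth sS LS); apply: filterS nL => y ->.
have e : dfun (fun y => psi (s y) (Lfield C tau taub y)) x (W x) =
    dfun f x (W x) - dfun fb x (W x) - dfun c x (W x) *: lvec.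
  apply: etrans (dfun_near_eq _ nL LS) _.
  apply: etrans (dfun_sub _ ffS clS) _; apply: (congr2 (fun a b => a - b)).
    exact: dfun_sub.
  apply: etrans (dfun_scale _ cS lS) _.
  have -> : dfun (fun=> lvec : L) x (W x) = 0 by exact: dfun_cst.
  by rewrite scaler0 addr0.
have eL := nablaCE sS W Sb LfS; rewrite e -(nbhs_singleton nL) in eL.
have eD := DCE sS (W x) St; have eW := nbhs_singleton (conn_psi sS) (W x).
apply: etrans (DCE sS (W x) Sb) _; apply/esym.
rewrite 2!psiB psiZ (PprojE_at _ Sb sx) psiD psiZ eL eD.
rewrite (tau_at _ St sx) (hmetric_at _ _ sx) (LfieldE_at St Sb sx).
rewrite -/(f x) -/(fb x) -/(c x); apply/esym.
set A := conn s x (W x) in eW *; set q := psi (s x) (W x) in eW *.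
set df := dfun f x (W x); set dfb := dfun fb x (W x); set dc := dfun c x (W x).
have -> : df - dfb - dc *: lvec + A *m (f x - fb x - c x *: lvec) =
    (df + A *m f x) - (dfb + A *m fb x) - dc *: lvec - c x *: q.
  rewrite 2!mulmxBr -scalemxAr eW.
  by rewrite addrACA (addrACA df) -(opprD dfb) addrA.
(* The derivative of the constant <g,l> = 1 pairs the covariant derivative of g with l; it is
   applied to both f and fb. *)
have perp (g : N -> L) (gS : smooth_fun_at g x) (Hg : \forall y \near x, lorentz (g y) lvec = 1) :
    lorentz (dfun g x (W x) + A *m g x) lvec = - lorentz (g x) q.
  have := covariant_lorentz s (W x) gS lS; rewrite -/A.
  have -> : dfun (fun y => lorentz (g y) lvec : R^o) x (W x) = 0.
    exact: (@dfun_near_cst _ _ _ R^o _ 1 x (W x) Hg).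
  have -> : dfun (fun=> lvec : L) x (W x) = 0 by exact: dfun_cst.
  by rewrite add0r eW => /eqP; rewrite eq_sym addr_eq0 => /eqP.
apply: pr_change_D; [exact: dual_null_at | exact: dual_null_at | exact: psi_perp | |].
- by apply: perp => //; apply: filterE => y; have [] := dual_null_at (s y) St.
- by apply: perp => //; apply: filterE => y; have [] := dual_null_at (s y) Sb.
Qed.

End WeylTransformation.

Theorem theorem6p9 (R : realType) (m d : nat) (hm : (2 <= m)%N)
    (N : manifold R m.+1) (P : manifold R d) (hN : connected_manifold N)
    (C : lightlike_cartan N P) :
  [/\ lightlike_metric (hmetric C) /\
      (smooth_vfield (Zfield C) /\
       forall x, spans (Zfield C x) (radical (hmetric C) x)),
      (forall tau, Sforms C tau -> metric_connection C tau (nablaC C tau)) /\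
      (forall tau taub, Sforms C tau -> Sforms C taub ->
       forall X W, An_section tau X -> smooth_vfield W -> forall x : N,
         nablaC C taub W (fun y => Pproj C taub y (X y)) x
         = Pproj C taub x (nablaC C tau W X x - taub x (X x) *: W x)
           - hmetric C x (X x) (W x) *: Lfield C tau taub x) &
      (forall tau, Sforms C tau -> An_bundle_morphism tau (DC C tau)) /\
      (forall tau taub, Sforms C tau -> Sforms C taub ->
       forall W, smooth_vfield W -> forall x : N,
         DC C taub x (W x)
         = Pproj C taub x (DC C tau x (W x)
             + (2^-1 * hmetric C x (Lfield C tau taub x) (Lfield C tau taub x))
               *: W x)
           - tau x (W x) *: Lfield C tau taub x
           - nablaC C taub W (Lfield C tau taub) x)].
Proof.
split.
- split; first exact: hmetric_lightlike.
  by split; [exact: Zfield_smooth | exact: Zfield_spans].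
- split; first exact: nabla_metric_connection.
  by move=> tau taub St Sb X W XS WS x; exact: nabla_transformation.
- split; first exact: DC_bundle_morphism.
  by move=> tau taub St Sb W WS x; exact: D_transformation.
Qed.
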